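(* Let $n\ge 1$. Then $\{x_\Gamma \mid \Gamma\in \mathbf T(\Pi_n)\}$ is the atomic basis of the cluster algebra $\mathcal A_{\Pi_n}$. Equivalently, the atomic basis of a coefficient-free cluster algebra $\mathcal A$ of type $A$ is the set of cluster monomials in $\mathcal A$.
   Context: **Cluster algebras.** A seed is a pair $(Q,\mathbf x)$ with $Q$ a finite connected quiver with $n$ vertices, without loops or oriented 2-cycles, and $\mathbf x=(x_1,\dots,x_n)$ a free generating set of the field $\mathbb Q(x_1,\dots,x_n)$ (the cluster of the seed). Mutation at $k$ replaces $x_k$ by $x_k'$ with $x_kx_k'=\prod_{i\to k}x_i+\prod_{k\to j}x_j$ (products over arrows of $Q$) and replaces $Q$ by its Fomin–Zelevinsky quiver mutation at $k$. The coefficient-free cluster algebra $\mathcal A_Q$ is the $\mathbb Z$-subalgebra of $\mathbb Q(x_1,\dots,x_n)$ generated by the elements (cluster variables) of all clusters of seeds obtained from $(Q,\mathbf x)$ by iterated mutations. A cluster monomial is a monomial (possibly $1$) in cluster variables all belonging to one cluster. By the Laurent phenomenon $\mathcal A_Q\subset\mathbb Z[c_1^{\pm1},\dots,c_n^{\pm1}]$ for every cluster $(c_1,\dots,c_n)$. An element of $\mathcal A_Q$ is positive if it lies in $\mathbb Z_{\ge0}[c_1^{\pm1},\dots,c_n^{\pm1}]$ for every cluster $(c_1,\dots,c_n)$ of $\mathcal A_Q$; $\mathcal A_Q^+$ denotes the set of positive elements. A $\mathbb Z$-basis $\mathcal B$ of $\mathcal A_Q$ is called an atomic basis if $\mathcal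 A_Q^+=\bigoplus_{b\in\mathcal B}\mathbb Z_{\ge0}\,b$; if it exists it is unique. $\mathcal A_Q$ is of type $A$ if, for some $n\geq 1$, $Q$ is mutation equivalent to an orientation of the Dynkin diagram $A_n$. **The polygon.** $\Pi_n$ is the disc with $n+3$ marked points on its boundary. An arc is an isotopy class (relative to the marked points) of curves in the disc joining two marked points, without self-intersection in the interior, and not isotopic to a boundary segment (component of boundary minus marked points). Two arcs are compatible if they are equal or have representatives which do not intersect in the interior. $\mathbf T(\Pi_n)$ is the set of finite, possibly empty, families (with multiplicity) of pairwise compatible arcs. A triangulation $T$ is a maximal set of pairwise distinct compatible arcs. Its quiver $Q_T$ has the arcs of $T$ as vertices, and for each triangle of $T$ and each pair of its sides $i,j$ that are arcs with $j$ following $i$ clockwise, an arrow $i\to j$ (then 2-cycles are deleted). $\mathcal A_{\Pi_n}:=\mathcal A_{Q_T}$ does not depend on $T$ and is of type $A_n$. There is a bijection $\gamma\mapsto x_\gamma$ from arcs to cluster variables under which triangulations correspond to clusters and flips of arcs to mutations. For $\Gamma\in\mathbf T(\Pi_n)$, $x_\Gamma=\prod_{\gamma\in\Gamma}x_\gamma$, with $x_\emptyset=1$; these are exactly the cluster monomials. *)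

(* Defs.v *)
From HB Require Import structures.
From mathcomp Require Import all_boot all_order all_fingroup all_algebra.
From mathcomp Require Export fraction mpoly.

Set Implicit Arguments.
Unset Strict Implicit.
Unset Printing Implicit Defensive.

Import GRing.Theory.
Local Open Scope ring_scope.

(** ** Quivers and seeds *)

(* [Q i j] is the number of arrows from [i] to [j]. *)
Definition quiver (n : nat) := 'M[nat]_n.

Definition no_loops_no_2cycles (n : nat) (Q : quiver n) : Prop :=
  (forall i, Q i i = 0%N) /\ (forall i j, Q i j = 0%N \/ Q j i = 0%N).

Definition quiver_connected (n : nat) (Q : quiver n) : Prop :=
  forall i j, connect (fun a b => (0 < Q a b)%N || (0 < Q b a)%N) i j.

(* Away from [k]: one arrow i -> j is added for every path i -> k -> j, then a
   maximal set of disjoint 2-cycles is removed (by the truncated subtraction).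
   At [k]: arrows are reversed. *)
Definition quiver_mutation (n : nat) (k : 'I_n) (Q : quiver n) : quiver n :=
  \matrix_(i, j)
    if (i == k) || (j == k) then Q j i
    else ((Q i j + Q i k * Q k j) - (Q j i + Q j k * Q k i))%N.

Definition quiver_mutations (n : nat) (ks : seq 'I_n) (Q : quiver n) :
  quiver n := foldl (fun Q' k => quiver_mutation k Q') Q ks.

(* [s] enumerates the vertices of [Q] along the Dynkin diagram A_n. *)
Definition orientation_of_An (n : nat) (Q : quiver n) : Prop :=
  exists s : {perm 'I_n}, forall i j : 'I_n,
    (Q (s i) (s j) + Q (s j) (s i))%N =
      ((j == i.+1 :> nat) || (i == j.+1 :> nat)) :> nat.

Definition type_A (n : nat) (Q : quiver n) : Prop :=
  exists ks : seq 'I_n, orientation_of_An (quiver_mutations ks Q).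

Definition cluster (F : Type) (n : nat) := {ffun 'I_n -> F}.

Definition seed_data (F : Type) (n : nat) := (quiver n * cluster F n)%type.

(* [F] is the field of rational functions over the rationals in the [c i]. *)
Definition free_generating (F : fieldType) (n : nat) (c : cluster F n) : Prop :=
  (forall p : {mpoly rat[n]}, mmap (@ratr F) c p = 0 -> p = 0) /\
  (forall y : F, exists p q : {mpoly rat[n]},
     mmap (@ratr F) c q != 0 /\ y = mmap (@ratr F) c p / mmap (@ratr F) c q).

Definition is_seed (F : fieldType) (n : nat) (s : seed_data F n) : Prop :=
  [/\ no_loops_no_2cycles s.1, quiver_connected s.1 & free_generating s.2].

Definition exchange (F : fieldType) (n : nat) (k : 'I_n) (s : seed_data F n) :
  F :=
  (\prod_i s.2 i ^+ s.1 i k + \prod_j s.2 j ^+ s.1 k j) / s.2 k.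

Definition seed_mutation (F : fieldType) (n : nat) (k : 'I_n)
    (s : seed_data F n) : seed_data F n :=
  (quiver_mutation k s.1,
   [ffun i => if i == k then exchange k s else s.2 i]).

Definition seed_mutations (F : fieldType) (n : nat) (ks : seq 'I_n)
    (s : seed_data F n) : seed_data F n :=
  foldl (fun s' k => seed_mutation k s') s ks.

(** ** The cluster algebra of a seed *)

Definition is_cluster (F : fieldType) (n : nat) (s : seed_data F n)
    (c : cluster F n) : Prop :=
  exists ks : seq 'I_n, c = (seed_mutations ks s).2.

Definition cluster_variable (F : fieldType) (n : nat) (s : seed_data F n)
    (y : F) : Prop :=
  exists c : cluster F n, is_cluster s c /\ exists i, y = c i.

Inductive generated_subring (F : fieldType) (G : F -> Prop) : F -> Prop :=
| gen_base y of G y : generated_subring G y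
| gen_one : generated_subring G 1
| gen_sub y z of generated_subring G y & generated_subring G z :
    generated_subring G (y - z)
| gen_mul y z of generated_subring G y & generated_subring G z :
    generated_subring G (y * z).

Definition cluster_algebra (F : fieldType) (n : nat) (s : seed_data F n) :
  F -> Prop := generated_subring (cluster_variable s).

Definition cluster_monomial (F : fieldType) (n : nat) (s : seed_data F n)
    (y : F) : Prop :=
  exists c : cluster F n, is_cluster s c /\
  exists e : 'I_n -> nat, y = \prod_i c i ^+ e i.

(* Membership in Z_{>=0}[c_1^{+-1}, ..., c_n^{+-1}]: a finite list of pairs
   (coefficient, exponent vector). *)
Definition nonneg_laurent (F : fieldType) (n : nat) (c : cluster F n) (y : F) :
  Prop :=
  exists l : seq (nat * {ffun 'I_n -> int}),
    y = \sum_(t <- l) t.1%:R * \prod_i (c i ^ t.2 i)%R.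

Definition positive_element (F : fieldType) (n : nat) (s : seed_data F n)
    (y : F) : Prop :=
  cluster_algebra s y /\ forall c, is_cluster s c -> nonneg_laurent c y.

(** ** Atomic bases *)

Definition Z_basis (F : fieldType) (A B : F -> Prop) : Prop :=
  [/\ forall b, B b -> A b,
      forall (l : seq F) (a : F -> int), uniq l -> {in l, forall b, B b} ->
        \sum_(b <- l) b *~ a b = 0 -> {in l, forall b, a b = 0}
    & forall y, A y -> exists (l : seq F) (a : F -> int),
        [/\ uniq l, {in l, forall b, B b} & y = \sum_(b <- l) b *~ a b]].

Definition nonneg_combination (F : fieldType) (B : F -> Prop) (y : F) : Prop :=
  exists (l : seq F) (a : F -> nat),
    [/\ uniq l, {in l, forall b, B b} & y = \sum_(b <- l) b *+ a b].

(* The sum of the Z_{>=0} b is direct because [B] is a Z-basis. *)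
Definition atomic_basis (F : fieldType) (n : nat) (s : seed_data F n)
    (B : F -> Prop) : Prop :=
  Z_basis (cluster_algebra s) B /\
  forall y, positive_element s y <-> nonneg_combination B y.

Definition the_atomic_basis (F : fieldType) (n : nat) (s : seed_data F n)
    (B : F -> Prop) : Prop :=
  atomic_basis s B /\
  forall B', atomic_basis s B' -> forall y, B' y <-> B y.

(** ** The polygon *)

(* The marked points are 0, 1, ..., n + 2, numbered clockwise. *)
Definition marked (n : nat) := 'I_n.+3.

Definition boundary_segment (n : nat) (p : marked n * marked n) : bool :=
  (p.2 == p.1.+1 :> nat) || ((p.1 == 0 :> nat) && (p.2 == n.+2 :> nat)).

(* The isotopy class of an arc is determined by its two endpoints, which are
   listed in increasing order. *)
Definition polygon_arc (n : nat) :=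
  {p : marked n * marked n | (p.1 < p.2)%N && ~~ boundary_segment p}.

(* Two arcs must intersect in the interior iff their endpoints interleave. *)
Definition crossing (n : nat) (g h : polygon_arc n) : bool :=
  let: (a, b) := val g in let: (c, d) := val h in
  [&& a < c, c < b & b < d]%N || [&& c < a, a < d & d < b]%N.

Definition compatible (n : nat) (g h : polygon_arc n) : bool := ~~ crossing g h.

Definition triangulation (n : nat) (S : {set polygon_arc n}) : bool :=
  maxset (fun U : {set polygon_arc n} =>
            [forall g in U, forall h in U, compatible g h]) S.

(* A triangulation whose arcs are labelled by [0, ..., n-1]. *)
Definition labelled_triangulation (n : nat)
    (T : {ffun 'I_n -> polygon_arc n}) : Prop :=
  injective T /\ triangulation [set T i | i : 'I_n].

Definition is_side (n : nat) (S : {set polygon_arc n})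
    (p : marked n * marked n) : bool :=
  boundary_segment p || [exists g in S, val g == p].

(* There is no marked point in the interior of the disc, so three vertices
   whose joining chords are sides span a triangle of the triangulation. *)
Definition triangle (n : nat) (S : {set polygon_arc n})
    (t : marked n * marked n * marked n) : bool :=
  let: (a, b, c) := t in
  [&& (a < b)%N, (b < c)%N, is_side S (a, b), is_side S (b, c)
    & is_side S (a, c)].

(* Clockwise, the sides of the triangle [a < b < c] are ab, bc, ca. *)
Definition follows_clockwise (n : nat) (t : marked n * marked n * marked n)
    (g h : polygon_arc n) : bool :=
  let: (a, b, c) := t in
  [|| (val g == (a, b)) && (val h == (b, c)),
      (val g == (b, c)) && (val h == (a, c))
    | (val g == (a, c)) && (val h == (a, b))].

Definition triangle_arrows (n : nat) (S : {set polygon_arc n})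
    (g h : polygon_arc n) : nat :=
  #|[set t | triangle S t && follows_clockwise t g h]|.

(* The truncated subtraction deletes 2-cycles. *)
Definition triangulation_quiver (n : nat) (T : {ffun 'I_n -> polygon_arc n}) :
  quiver n :=
  let S := [set T i | i : 'I_n] in
  \matrix_(i, j)
    (triangle_arrows S (T i) (T j) - triangle_arrows S (T j) (T i))%N.

Definition polygon_seed (F : fieldType) (n : nat) (x : polygon_arc n -> F)
    (T : {ffun 'I_n -> polygon_arc n}) : seed_data F n :=
  (triangulation_quiver T, [ffun i => x (T i)]).

(* [T'] is obtained from [T] by flipping the arc labelled [k]. *)
Definition is_flip (n : nat) (k : 'I_n)
    (T T' : {ffun 'I_n -> polygon_arc n}) : Prop :=
  T' k != T k /\ forall i, i != k -> T' i = T i.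

(* [x] is the bijection from arcs to the cluster variables of the cluster
   algebra with initial seed [(Q_T, c)], extending [T i |-> c i]. *)
Definition arc_bijection (F : fieldType) (n : nat)
    (T : {ffun 'I_n -> polygon_arc n}) (c : cluster F n)
    (x : polygon_arc n -> F) : Prop :=
  let s := (triangulation_quiver T, c) in
  [/\ forall i, x (T i) = c i,
      injective x /\ (forall y, cluster_variable s y <-> exists g, y = x g),
      (forall S, triangulation S ->
         exists2 c', is_cluster s c' & codom c' =i [seq x g | g in S]) /\
      (forall c', is_cluster s c' ->
         exists2 S, triangulation S & codom c' =i [seq x g | g in S])
    & forall k U U', labelled_triangulation U -> labelled_triangulation U' ->
        is_flip k U U' ->
        seed_mutation k (polygon_seed x U) = polygon_seed x U'].

(* A finite family of arcs is given by its multiplicity function. *)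
Definition compatible_family (n : nat) (G : {ffun polygon_arc n -> nat}) :
  Prop :=
  forall g h, (0 < G g)%N -> (0 < G h)%N -> compatible g h.

Definition arc_monomial (F : fieldType) (n : nat) (x : polygon_arc n -> F)
    (G : {ffun polygon_arc n -> nat}) : F := \prod_g x g ^+ G g.

(* Main.v *)
Require Import Defs.
From mathcomp Require Import all_boot all_order all_fingroup all_algebra.
From mathcomp Require Import fraction mpoly.
From mathcomp Require Import zify ring.

Set Implicit Arguments.
Unset Strict Implicit.
Unset Printing Implicit Defensive.

Import GRing.Theory Num.Theory Order.TTheory.

(** Arcs are given values by a function [X] of two vertices that satisfies
    Ptolemy's relation for crossing chords and is 1 on boundary segments.  For the
    fan, the triangulation whose arcs all end at the vertex 0, such a function
    exists with arbitrary nonzero values on the arcs: it consists of determinants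
    of vectors in the plane ([exists_ptolemaic]).  A flip exchanges the diagonals
    of a quadrilateral; it mutates the quiver of the triangulation
    ([quiver_flip]), and Ptolemy's relation is the exchange relation
    ([seed_flip]).  Since flips connect all triangulations ([flip_connected]), the
    clusters are the sets of values of [X] on triangulations, for any initial
    triangulation and free cluster ([exists_arc_values]), and the values on one
    triangulation determine all others ([arc_bijection_unique]).

    The monomials in pairwise compatible arcs span the cluster algebra, because
    Ptolemy's relation replaces a product of two crossing arcs by two products of
    smaller weight ([chord_product_comb]).

    Linear independence and atomicity have one source: if a compatible family is
    not contained in a triangulation [T], then in the expansion of its monomial in
    the cluster of [T] no Laurent monomial has only nonnegative exponents
    ([arc_monomial_proper]).  Indeed, let [g] be an arc of the family outside [T],
    and give a chord the degree 1 if it crosses [g], -1 if it is [g], and 0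
    otherwise.  This degree satisfies the tropical form of Ptolemy's relation, so
    it bounds the degrees of the Laurent monomials in the expansion of any chord
    ([chord_expands]), which also shows that the coefficients are nonnegative.  It
    is nonnegative on the arcs of [T], but negative on the family.  Hence, if [T]
    contains the family of a monomial [b0], the coefficient of [b0] in a
    combination of compatible monomials can be read off from the expansion in the
    cluster of [T] ([detecting_coef]): it is zero if the sum is zero, and
    nonnegative if the sum is positive.  An atomic basis is unique because it
    consists of the indecomposable positive elements ([atomic_basis_sub]).

    For a seed of type A, some mutations lead to an orientation of the diagram
    [A_n], which is the quiver of a triangulation ([type_A_triangulation]).  As
    mutations are involutions, both seeds have the same clusters. *)


(** * Statements about the relative order of a few numbers *)

Definition order_table (s : seq nat) : seq (seq bool) :=
  [seq [seq x < y | y <- s] | x <- s].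

Definition lt_at (t : seq (seq bool)) (i j : nat) : bool :=
  nth false (nth [::] t i) j.

Fixpoint words (m k : nat) : seq (seq nat) :=
  if k is k'.+1 then flatten [seq [seq x :: w | x <- iota 0 m] | w <- words m k']
  else [:: [::]].

Lemma mem_words m k w : size w = k -> all (fun x => x < m) w -> w \in words m k.
Proof.
elim: k w => [|k IH] [|x w] //= [sw] /andP[xm wm].
apply/flatten_mapP; exists w; first exact: IH.
by apply/mapP; exists x; rewrite ?mem_iota.
Qed.

(** Replacing each number by its rank among the given ones does not change the
    order table, so a statement on the relative order of [k] numbers holds
    in general as soon as it holds for all numbers below [k]. *)
Lemma order_decide (k : nat) (psi : seq (seq bool) -> bool) (s : seq nat) :
  all (fun w => psi (order_table w)) (words k k) -> size s = k ->
  psi (order_table s).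
Proof.
move=> /allP chk sz.
pose rk x := count (fun z => z < x) s.
have rk_lt x y : x \in s -> x < y -> rk x < rk y.
  move=> xs xy; rewrite /rk -(size_filter _ s) -(size_filter (fun z => z < y)).
  rewrite -(count_predC (fun z => z < x) [seq z <- s | z < y]) count_filter.
  rewrite size_filter (@eq_count _ (predI _ _) (fun z => z < x)); last first.
    by move=> z /=; case: (ltnP z x) => //= /ltn_trans; apply.
  rewrite -[X in X < _]addn0 ltn_add2l -has_count.
  by apply/hasP; exists x; rewrite ?mem_filter ?xy //= ltnn.
have rkE x y : x \in s -> y \in s -> (rk x < rk y) = (x < y).
  move=> xs ys; case: (ltnP x y) => xy; first exact: rk_lt.
  apply/negbTE; rewrite -leqNgt; apply: sub_count => z /= zy.
  exact: leq_trans zy xy.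
have -> : order_table s = order_table (map rk s).
  rewrite /order_table -map_comp; apply/eq_in_map => x xs /=.
  by rewrite -map_comp; apply/eq_in_map => y ys /=; rewrite rkE.
apply: chk; apply: mem_words; first by rewrite size_map.
apply/allP => _ /mapP[x xs ->]; rewrite -sz /rk -(count_predC (fun z => z < x) s).
rewrite -[X in X < _]addn0 ltn_add2l -has_count.
by apply/hasP; exists x => //=; rewrite ltnn.
Qed.

Lemma eqn_lt (x y : nat) : (x == y) = ~~ (x < y) && ~~ (y < x).
Proof. by case: ltngtP. Qed.

(** * Cyclic order and crossing chords *)

(** The points [a], [b], [c] of a circle are distinct and met in this order
    when it is traversed clockwise. *)
Definition cyc (a b c : nat) : bool :=
  [|| (a < b) && (b < c), (b < c) && (c < a) | (c < a) && (a < b)].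

Definition cross (a b p q : nat) : bool :=
  cyc a p b && cyc b q a || cyc a q b && cyc b p a.

(** Rewrites the comparisons of entries of [s] as look-ups in the table [t]. *)
Ltac order_fold t s :=
  let rec inner x i s' j :=
    lazymatch s' with
    | ?y :: ?s'' => change (x < y) with (lt_at t i j); inner x i s'' (S j)
    | _ => idtac
    end in
  let rec outer s' i :=
    lazymatch s' with
    | ?x :: ?s'' => inner x i s 0%nat; outer s'' (S i)
    | _ => idtac
    end in
  outer s 0%nat.

(** Proves an implication that depends only on the relative order of the numbers
    in [s], by testing it on all words of that length. *)
Ltac order_tac s :=
  intros;
  repeat match goal with
  | H : is_true _ |- is_true _ => move: H; apply/implyP
  end;
  rewrite /cross /cyc ?eqn_lt;
  order_fold (order_table s) s;
  pattern (order_table s);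
  lazymatch goal with
  | |- (fun t => is_true (@?psi t)) _ =>
      apply: (@order_decide (size s) psi s _ erefl);
      (* unfolded to conditionals, the connectives are evaluated lazily *)
      cbv beta delta [andb orb implb negb]; vm_compute; reflexivity
  end.

Lemma crossC a b p q : cross a b p q = cross p q a b.
Proof. by apply/eqP; order_tac [:: a; b; p; q]. Qed.

Lemma cross_swap a b p q : cross a b p q = cross b a p q.
Proof. by apply/eqP; order_tac [:: a; b; p; q]. Qed.

Lemma cross_swapr a b p q : cross a b p q = cross a b q p.
Proof. by rewrite crossC cross_swap crossC. Qed.

Lemma crossE a b p q : a < b -> p < q ->
  cross a b p q = [&& a < p, p < b & b < q] || [&& p < a, a < q & q < b].
Proof. by move=> lab lpq; apply/eqP; move: lab lpq; order_tac [:: a; b; p; q]. Qed.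

Lemma cross_between a b p q : a < b -> cross a b p q ->
  ((a < p < b) || (a < q < b)) && [|| p < a, q < a, b < p | b < q].
Proof. by order_tac [:: a; b; p; q]. Qed.

Lemma cross_irr a b : ~~ cross a b a b.
Proof. by order_tac [:: a; b]. Qed.

Section Polygon.

Variable n : nat.
Implicit Types (a b p q r s u v w : marked n) (g h : polygon_arc n).
Implicit Types (S : {set polygon_arc n}).

Definition joins g u v : bool := (val g == (u, v)) || (val g == (v, u)).

Definition seg u v : bool := boundary_segment (u, v) || boundary_segment (v, u).

Definition side S u v : bool := seg u v || [exists g in S, joins g u v].

Lemma joinsC g u v : joins g u v = joins g v u.
Proof. by rewrite /joins orbC. Qed.

Lemma segC u v : seg u v = seg v u.
Proof. by rewrite /seg orbC. Qed.

Lemma sideC S u v : side S u v = side S v u.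
Proof.
by rewrite /side segC; congr (_ || _); apply: eq_existsb => g; rewrite joinsC.
Qed.

Lemma arc_lt g : (val g).1 < (val g).2.
Proof. by case/andP: (valP g). Qed.

Lemma joins_val g : joins g (val g).1 (val g).2.
Proof. by rewrite /joins -surjective_pairing eqxx. Qed.

Lemma joins_neq g u v : joins g u v -> u != v.
Proof.
have := arc_lt g; rewrite /joins => lt_g /orP[] /eqP eg; move: lt_g; rewrite eg /=;
  by apply: contraTneq => ->; rewrite ltnn.
Qed.

Lemma joins_eq g u v r s : joins g u v -> joins g r s ->
  (u, v) = (r, s) \/ (u, v) = (s, r).
Proof.
rewrite /joins => /orP[] /eqP -> /orP[] /eqP [-> ->]; by [left | right].
Qed.

Lemma joins_inj g h u v : joins g u v -> joins h u v -> g = h.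
Proof.
have := arc_lt g; have := arc_lt h.
rewrite /joins => lh lg /orP[] /eqP eg /orP[] /eqP eh;
  apply: val_inj; rewrite eg eh //; move: lg lh; rewrite eg eh /=; lia.
Qed.

Lemma seg_neq u v : seg u v -> u != v.
Proof.
apply: contraTneq => ->; rewrite /seg /boundary_segment /=.
by apply/negP; case: v => v vn /=; lia.
Qed.

Lemma seg_joins g u v : seg u v -> ~~ joins g u v.
Proof.
rewrite /seg /joins; case/andP: (valP g) => lt_g ng s; apply/negP => /orP[] /eqP eg;
  move: lt_g ng s; rewrite eg /boundary_segment /=; lia.
Qed.

Lemma seg_lt u v : u < v -> seg u v = boundary_segment (u, v).
Proof. by rewrite /seg /boundary_segment /=; lia. Qed.

Lemma seg_succ u v : v = u.+1 :> nat -> seg u v.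
Proof. by move=> e; rewrite /seg /boundary_segment /= e eqxx. Qed.

Lemma side_neq S u v : side S u v -> u != v.
Proof.
by case/orP => [/seg_neq //|/existsP[g /andP[_]]]; apply: joins_neq.
Qed.

Lemma exists_arc u v : u != v -> ~~ seg u v -> exists g, joins g u v.
Proof.
wlog lt_uv : u v / u < v => [th | neq nseg].
  case: (ltngtP u v) => [lt_uv|lt_vu|/val_inj ->]; last by rewrite eqxx.
  - exact: th.
  - rewrite segC eq_sym => neq nseg; have [g] := th _ _ lt_vu neq nseg.
    by rewrite joinsC; exists g.
have ok : ((u, v).1 < (u, v).2) && ~~ boundary_segment (u, v).
  by rewrite lt_uv; move: nseg; rewrite /seg negb_or => /andP[].
by exists (exist _ (u, v) ok); rewrite /joins /= eqxx.
Qed.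

Lemma crossing_joins g h u v r s : joins g u v -> joins h r s ->
  crossing g h = cross u v r s.
Proof.
have crossing_cross : crossing g h = cross (val g).1 (val g).2 (val h).1 (val h).2.
  have := arc_lt g; have := arc_lt h; rewrite /crossing.
  by case: (val g) (val h) => [a b] [c d] /= lcd lab; rewrite crossE.
rewrite crossing_cross /joins => /orP[] /eqP -> /orP[] /eqP -> //=.
- by rewrite cross_swapr.
- by rewrite cross_swap.
- by rewrite cross_swap cross_swapr.
Qed.

Lemma crossingC g h : crossing g h = crossing h g.
Proof.
by rewrite !(crossing_joins (joins_val _) (joins_val _)) crossC.
Qed.

Lemma seg_cross u v (r s : marked n) : seg u v -> ~~ cross u v r s.
Proof.
wlog : u v / boundary_segment (u, v) => [th|].
  by case/orP=> sg; [|rewrite cross_swap]; apply: th; rewrite /seg sg ?orbT.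
move=> + _; rewrite /boundary_segment /= => sg; apply/negP => /cross_between.
have := ltn_ord r; have := ltn_ord s; move: sg; lia.
Qed.

Lemma triangulationP S : triangulation S <->
  (forall g h, g \in S -> h \in S -> ~~ crossing g h) /\
  (forall g, (forall h, h \in S -> ~~ crossing g h) -> g \in S).
Proof.
rewrite /triangulation; split.
  case/maxsetP => nc mx; split.
    by move=> g h gS hS; have /forall_inP/(_ g gS)/forall_inP/(_ h hS) := nc.
  move=> g ncg; have <- : g |: S = S; last by rewrite setU11.
  apply: mx; last exact: subsetUr.
  apply/forall_inP => x /setU1P xS; apply/forall_inP => y /setU1P yS.
  rewrite /compatible; case: xS => [->|xS]; case: yS => [->|yS].
  - by rewrite (crossing_joins (joins_val _) (joins_val _)) cross_irr.
  - exact: ncg.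
  - by rewrite crossingC; apply: ncg.
  - by have /forall_inP/(_ x xS)/forall_inP/(_ y yS) := nc.
case=> nc mx; apply/maxsetP; split.
  by apply/forall_inP => g gS; apply/forall_inP => h; apply: nc.
move=> U ncU sSU; apply/eqP; rewrite eqEsubset sSU andbT; apply/subsetP => g gU.
apply: mx => h hS; have /forall_inP/(_ g gU)/forall_inP := ncU.
by apply; apply: (subsetP sSU).
Qed.

Lemma sideP S u v : reflect (seg u v \/ exists2 g, g \in S & joins g u v) (side S u v).
Proof.
apply: (iffP orP) => -[sg|]; [by left| |by left|].
  by case/existsP => g /andP[]; right; exists g.
by case=> g gS j; right; apply/existsP; exists g; rewrite gS.
Qed.

Lemma side_cross S u v r s : triangulation S -> side S u v -> side S r s ->
  ~~ cross u v r s.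
Proof.
case/triangulationP=> nc _ /sideP[sg _|[g gS gj]]; first exact: seg_cross.
case/sideP=> [sg|[h hS hj]]; first by rewrite crossC; apply: seg_cross.
by rewrite -(crossing_joins gj hj); apply: nc.
Qed.

Lemma side_max S u v : triangulation S -> u != v ->
  (forall r s, side S r s -> ~~ cross u v r s) -> side S u v.
Proof.
case/triangulationP=> _ mx neq nc; apply/sideP.
case: (boolP (seg u v)) => [|nseg]; [by left|right].
have [g gj] := exists_arc neq nseg; exists g => //; apply: mx => h hS.
rewrite (crossing_joins gj (joins_val h)); apply: nc; apply/sideP; right.
by exists h; rewrite ?joins_val.
Qed.

Lemma side_arc S g u v : joins g u v -> side S u v = (g \in S).
Proof.
move=> gj; apply/sideP/idP => [[sg|[h hS hj]]|gS].
- by rewrite (negbTE (seg_joins g sg)) in gj.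
- by rewrite (joins_inj gj hj).
- by right; exists g.
Qed.

End Polygon.

(** * Triangulations and flips *)

Lemma cyc_rot a b c : cyc a b c = cyc b c a.
Proof. by apply/eqP; order_tac [:: a; b; c]. Qed.

Lemma cyc_insert a p r b : cyc a p b -> cyc p r b -> cyc a p r && cyc a r b.
Proof. by order_tac [:: a; p; r; b]. Qed.

Lemma outer_end a p b r s : cyc a p b -> cyc p r b -> cyc b s p ->
  ~~ cross a b r s -> ~~ cross a p r s -> s == a.
Proof. by order_tac [:: a; p; b; r; s]. Qed.

Lemma cyc_neq (a b c : nat) : cyc a b c -> [&& a != b, b != c & a != c].
Proof. by order_tac [:: a; b; c]. Qed.

Lemma same_apex a b p q : cyc a p b -> cyc a q b ->
  ~~ cross a p q b -> ~~ cross a q p b -> p == q.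
Proof. by order_tac [:: a; b; p; q]. Qed.

Lemma crossing_end_at_apex a b p r s : cyc a p b -> cyc a r b -> cyc b s a ->
  ~~ cross r s a p -> ~~ cross r s p b -> r == p.
Proof. by order_tac [:: a; b; p; r; s]. Qed.

Lemma quad_cyc a p b q : cyc a p b -> cyc b q a -> cyc p b q && cyc q a p.
Proof. by order_tac [:: a; p; b; q]. Qed.

Lemma diagonals_cross a p b q : cyc a p b -> cyc b q a -> cross a b p q.
Proof. by order_tac [:: a; p; b; q]. Qed.

Lemma opposite_neq (a p b q : nat) : cyc a p b -> cyc b q a -> p != q.
Proof. by order_tac [:: a; p; b; q]. Qed.

Lemma cyc_between (a b c : nat) : a < c -> cyc a b c -> a < b < c.
Proof. by order_tac [:: a; b; c]. Qed.

Section Flips.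

Variable n : nat.
Implicit Types (a b p q r s u v w : marked n) (g h : polygon_arc n).
Implicit Types (S : {set polygon_arc n}) (T : {ffun 'I_n -> polygon_arc n}).

Lemma cyc_ord_neq a b p : cyc a p b -> [/\ a != p, p != b & a != b].
Proof. by case/cyc_neq/and3P. Qed.

(** Among the vertices joined to [a] and lying strictly between [a] and [b], take
    the one farthest from [a].  An arc of [S] that crosses [p b] crosses neither
    [a b] nor [a p], so it ends at [a], and its other end is farther than [p]. *)
Lemma third_vertex S a b w : triangulation S -> side S a b -> cyc a w b ->
  exists p, [/\ cyc a p b, side S a p & side S p b].
Proof.
move=> triS sab awb.
(* the number of clockwise steps from [a] to [x] *)
pose dist (x : marked n) := if a < x then x - a else x + n.+3 - a.
have dist_lt (x y : marked n) : cyc a x y -> dist x < dist y.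
  rewrite /dist /cyc; have := ltn_ord x; have := ltn_ord y; have := ltn_ord a.
  by case: (ltnP a x); case: (ltnP a y); lia.
have lt_succ : (if a.+1 < n.+3 then a.+1 else 0) < n.+3 by case: ifP.
pose a' : marked n := Ordinal lt_succ.
have seg_aa' : seg a a'.
  rewrite /seg /boundary_segment /=; have := ltn_ord a.
  by case: (ltnP a.+1 n.+3) => /=; lia.
have P0 : cyc a a' b && side S a a'.
  apply/andP; split; last by rewrite /side seg_aa'.
  have neq : a' != b.
    apply: contraTneq awb => <-; apply/negP.
    have := ltn_ord w; have := ltn_ord a; rewrite /cyc /=.
    by case: (ltnP a.+1 n.+3); lia.
  move: awb neq; rewrite -val_eqE /cyc /=; have := ltn_ord b; have := ltn_ord a.
  by case: (ltnP a.+1 n.+3); lia.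
case: (@arg_maxnP _ a' (fun p => cyc a p b && side S a p) dist P0) => p /andP[apb sap] max_p.
exists p; split=> //.
have [nap npb _] := cyc_ord_neq apb.
have half (r s : marked n) : side S r s -> cyc p r b -> cyc b s p -> False.
  move=> srs prb bsp; have [apr arb] := andP (cyc_insert apb prb).
  have sa : s = a.
    by apply/val_inj/eqP/(outer_end apb prb bsp); apply: side_cross srs.
  have /max_p : cyc a r b && side S a r by rewrite arb sideC -sa.
  by move/(leq_trans (dist_lt _ _ apr)); rewrite ltnn.
apply: side_max triS npb _ => r s srs; apply/negP => /orP[] /andP[].
  exact: half.
by apply: half; rewrite sideC.
Qed.

Lemma third_vertex_uniq S a b p q : triangulation S -> cyc a p b -> cyc a q b ->
  side S a p -> side S p b -> side S a q -> side S q b -> p = q.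
Proof.
move=> triS apb aqb sap spb saq sqb; apply/val_inj/eqP.
by apply: (same_apex apb aqb); apply: side_cross triS _ _.
Qed.

Definition quad S a p b q : bool :=
  [&& cyc a p b, cyc b q a, side S a p, side S p b, side S b q & side S q a].

Lemma quad_rot S a p b q : quad S a p b q -> quad S p b q a.
Proof.
case/and5P=> apb bqa sap spb /andP[sbq sqa].
by have /andP[c1 c2] := quad_cyc apb bqa; apply/and5P; split; rewrite ?sap ?sqa.
Qed.

Lemma side_arc_between S g a b : joins g a b -> exists w, cyc a w b.
Proof.
wlog lt_ab : a b / a < b => [th gj | gj].
  have := joins_neq gj; rewrite -val_eqE /=; case: ltngtP => // lt_ba _.
    exact: th.
  have [lo | hi] := posnP b; last first.
    by exists ord0; rewrite /cyc /=; lia.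
  have lt : a.+1 < n.+3.
    rewrite ltnS ltn_neqAle -ltnS ltn_ord andbT; apply: contraTneq gj => ea.
    by apply: seg_joins; rewrite /seg /boundary_segment /= lo ea eqxx orbT.
  by exists (Ordinal lt); rewrite /cyc /=; lia.
have lt : a.+1 < b.
  rewrite ltn_neqAle lt_ab andbT; apply: contraTneq gj => eb.
  by apply: seg_joins; rewrite /seg /boundary_segment /= eb eqxx.
by exists (Ordinal (ltn_trans lt (ltn_ord b))); rewrite /cyc /=; lia.
Qed.

Lemma exists_quad S g a b : triangulation S -> g \in S -> joins g a b ->
  exists p q, quad S a p b q.
Proof.
move=> triS gS gj; have sab : side S a b by rewrite (side_arc S gj).
have [w aw] := side_arc_between S gj; have [p [apb sap spb]] := third_vertex triS sab aw.
have gj' : joins g b a by rewrite joinsC.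
have [w' bw] := side_arc_between S gj'; rewrite sideC in sab.
have [q [bqa sbq sqa]] := third_vertex triS sab bw.
by exists p, q; apply/and5P; split; rewrite ?sbq.
Qed.


(** A chord that enters the triangle [a p b] through [a b] and crosses none of
    the other two sides ends at [p]; likewise it ends at [q] on the other side. *)
Lemma quad_diagonal S a p b q r s : quad S a p b q -> cross r s a b ->
  ~~ cross r s a p -> ~~ cross r s p b -> ~~ cross r s b q -> ~~ cross r s q a ->
  (r, s) = (p, q) \/ (r, s) = (q, p).
Proof.
case/and5P=> apb bqa _ _ _ c nap npb nbq nqa.
have ends (x y : marked n) : cyc a x b -> cyc b y a -> ~~ cross x y a p -> ~~ cross x y p b ->
    ~~ cross x y b q -> ~~ cross x y q a -> (x, y) = (p, q).
  move=> axb bya xap xpb xbq xqa.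
  have /eqP/val_inj -> := crossing_end_at_apex apb axb bya xap xpb.
  congr (_, _); apply/val_inj/eqP/(crossing_end_at_apex bqa bya axb);
    by rewrite cross_swap.
rewrite crossC in c; case/orP: c => /andP[c1 c2]; [left | right].
  exact: ends.
by have [-> ->] : (s, r) = (p, q) by apply: ends; rewrite 1?cross_swap.
Qed.

End Flips.

Section FlipConnectivity.

Variable n : nat.
Implicit Types (a b p q r s u v w : marked n) (g h : polygon_arc n).
Implicit Types (S : {set polygon_arc n}) (T : {ffun 'I_n -> polygon_arc n}).

Lemma quad_neq S a p b q : quad S a p b q -> p != q.
Proof.
by case/and3P=> apb bqa _; rewrite -val_eqE; apply: opposite_neq apb bqa.
Qed.

Lemma quad_cross S a p b q g h : quad S a p b q -> joins g a b -> joins h p q ->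
  crossing g h.
Proof.
by case/and3P=> apb bqa _ gj hj; rewrite (crossing_joins gj hj) diagonals_cross.
Qed.

Lemma crossing_irr g : ~~ crossing g g.
Proof. by rewrite (crossing_joins (joins_val g) (joins_val g)) cross_irr. Qed.

Lemma joins_opp_disjoint S a p b q g : quad S a p b q -> joins g a b ->
  [/\ ~~ joins g a p, ~~ joins g p b, ~~ joins g b q & ~~ joins g q a].
Proof.
case/and3P=> /cyc_ord_neq[ap pb ab] /cyc_ord_neq[bq qa _] _ gj.
by split; apply/negP => /(joins_eq gj) [] e; case: e => *; subst;
  move: ap pb ab bq qa; rewrite ?eqxx.
Qed.

Lemma side_flip S g h u v :
  side (h |: S :\ g) u v = (side S u v && ~~ joins g u v) || joins h u v.
Proof.
apply/sideP/orP.
  case=> [sg|[x xS xj]].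
    by left; rewrite /side sg; apply: seg_joins.
  case/setU1P: xS => [<-|/setD1P[xg xS]]; [by right | left].
  rewrite (side_arc S xj) xS; apply: contra xg => gj.
  by rewrite (joins_inj xj gj).
case=> [/andP[/sideP[sg|[x xS xj]] ng]|hj].
- by left.
- right; exists x => //; rewrite !inE xS andbT; apply/orP; right.
  by apply: contra ng => /eqP <-.
- by right; exists h; rewrite ?setU11.
Qed.

Section OneFlip.

Variables (S : {set polygon_arc n}) (g h : polygon_arc n) (a p b q : marked n).
Hypotheses (triS : triangulation S) (gS : g \in S).
Hypotheses (gj : joins g a b) (hj : joins h p q) (Q : quad S a p b q).

Lemma flip_crossing_unique x u v : joins x u v ->
  (forall y, y \in S :\ g -> ~~ crossing x y) -> crossing x g -> x = h.
Proof.
move=> xj nc cx; have [j1 j2 j3 j4] := joins_opp_disjoint Q gj.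
have ncside r s : side S r s -> ~~ joins g r s -> ~~ cross u v r s.
  case/sideP=> [sg _|[y yS yj] ngj]; first by rewrite crossC seg_cross.
  rewrite -(crossing_joins xj yj); apply: nc; rewrite !inE yS andbT.
  by apply: contra ngj => /eqP <-.
case/and5P: (Q) => _ _ sap spb /andP[sbq sqa].
move: cx; rewrite (crossing_joins xj gj) => cx.
case: (quad_diagonal Q cx) => [||||[eu ev]|[eu ev]]; try exact: ncside.
  by apply: (joins_inj xj); rewrite eu ev.
by apply: (joins_inj xj); rewrite eu ev joinsC.
Qed.

(** An arc compatible with all arcs but [g] is compatible with the four sides of
    the quadrilateral, so it is [h] if it crosses [g]. *)
Lemma flip_triangulation : triangulation (h |: S :\ g).
Proof.
have /triangulationP[nc mx] := triS.
have chg : crossing h g by rewrite crossingC; apply: quad_cross Q gj hj.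
have [j1 j2 j3 j4] := joins_opp_disjoint Q gj.
case/and5P: (Q) => apb bqa sap spb /andP[sbq sqa].
have [bqp qap] := andP (quad_cyc apb bqa).
have nch y : y \in S :\ g -> ~~ crossing h y.
  case/setD1P=> yg yS; apply: contra yg; rewrite crossingC => cyh.
  have yj := joins_val y; have ys : side S (val y).1 (val y).2 by rewrite (side_arc S yj).
  rewrite (crossing_joins yj hj) in cyh.
  case: (quad_diagonal (quad_rot Q) cyh); try exact: side_cross ys _.
    by case=> e1 e2; apply/eqP/(joins_inj yj); rewrite e1 e2 joinsC.
  by case=> e1 e2; apply/eqP/(joins_inj yj); rewrite e1 e2.
apply/triangulationP; split.
  move=> x y /setU1P[->|xS] /setU1P[->|yS].
  - exact: crossing_irr.
  - exact: nch.
  - by rewrite crossingC nch.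
  - by apply: nc; [case/setD1P: xS | case/setD1P: yS].
move=> x ncx; have ncS y : y \in S :\ g -> ~~ crossing x y.
  by move=> yS; apply: ncx; rewrite in_setU yS orbT.
case: (boolP (crossing x g)) => [cx | ncg].
  by rewrite (flip_crossing_unique (joins_val x) ncS cx) setU11.
have xS : x \in S.
  apply: mx => y yS; case: (eqVneq y g) => [-> //|yg].
  by apply: ncS; rewrite !inE yg.
rewrite !inE xS andbT; apply/orP; right; apply/eqP => xg.
by have := ncx h (setU11 _ _); rewrite xg crossingC chg.
Qed.

Lemma flip_new : h \notin S.
Proof.
apply/negP => hS; have /triangulationP[nc _] := triS.
by have := nc g h gS hS; rewrite (quad_cross Q gj hj).
Qed.

Lemma quad_flip : quad (h |: S :\ g) p b q a.
Proof.
have [j1 j2 j3 j4] := joins_opp_disjoint Q gj.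
case/and5P: (quad_rot Q) => apb bqa sap spb /andP[sbq sqa].
by apply/and5P; split; rewrite ?side_flip ?sap ?spb ?sbq ?sqa ?j1 ?j2 ?j3 ?j4.
Qed.

End OneFlip.

Lemma triangulation_incl S S' : triangulation S -> triangulation S' ->
  S \subset S' -> S = S'.
Proof.
by case/maxsetP=> _ mx /maxsetP[nc _] sub; rewrite (mx _ nc sub).
Qed.

(** By maximality of [S] the new arc crosses [g]; as it is compatible with the
    sides of the quadrilateral around [g], it is the other diagonal. *)
Lemma flip_quad S g h : triangulation S -> triangulation (h |: S :\ g) ->
  g \in S -> h != g ->
  exists a p b q, [/\ joins g a b, joins h p q & quad S a p b q].
Proof.
move=> triS triS' gS hg.
have hS : h \notin S.
  apply/negP => hS.
  have sub : h |: S :\ g \subset S by rewrite subUset sub1set hS subD1set.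
  have e := triangulation_incl triS' triS sub.
  by have := gS; rewrite -e !inE eqxx /= orbF eq_sym (negbTE hg).
have /triangulationP[nc' _] := triS'; have /triangulationP[_ mx] := triS.
have nch y : y \in S :\ g -> ~~ crossing h y.
  by move=> yS; apply: nc'; rewrite ?setU11 // in_setU yS orbT.
have chg : crossing h g.
  apply: contraNT hS => ncg; apply: mx => y yS.
  by case: (eqVneq y g) => [-> //|yg]; apply: nch; rewrite !inE yg.
have gj := joins_val g; have [p [q Q]] := exists_quad triS gS gj.
exists (val g).1, p, (val g).2, q; split=> //.
case/and5P: (Q) => apb bqa sap spb /andP[sbq sqa].
have pq := quad_neq Q.
have [h' hj'] : exists h', joins h' p q.
  apply: exists_arc => //; apply/negP => sg.
  have := seg_cross (val g).1 (val g).2 sg.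
  by rewrite crossC diagonals_cross.
by rewrite (flip_crossing_unique gj hj' Q (joins_val h) nch chg).
Qed.

Lemma exists_flip S g : triangulation S -> g \in S ->
  exists2 h, h \notin S & triangulation (h |: S :\ g).
Proof.
move=> triS gS; have gj := joins_val g; have [p [q Q]] := exists_quad triS gS gj.
have [h hj] : exists h, joins h p q.
  apply: (exists_arc (quad_neq Q)); apply/negP => sg.
  have := seg_cross (val g).1 (val g).2 sg; case/and3P: Q => apb bqa _.
  by rewrite crossC diagonals_cross.
by exists h; [apply: flip_new triS gS gj hj Q | apply: flip_triangulation triS gj hj Q].
Qed.

Definition fan : {set polygon_arc n} := [set g : polygon_arc n | (val g).1 == 0 :> nat].

Definition apex_degree S : nat := #|[set v | side S (ord0 : marked n) v]|.

(** Let [v] be the first vertex not joined to 0 and [j] its predecessor.  The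
    triangle beyond the chord from 0 to [j] has a side [j p] opposite to 0 with
    [v] beyond it, and flipping [j p] creates an arc that ends at 0. *)
Lemma flip_towards_fan S : triangulation S -> S <> fan ->
  exists g h, [/\ g \in S, h \notin S, triangulation (h |: S :\ g)
                & apex_degree S < apex_degree (h |: S :\ g)].
Proof.
move=> triS nfan; pose o : marked n := ord0.
have [v0 v0P] : exists v : marked n, (0 < v) && ~~ side S o v.
  apply/existsP; case: (boolP [exists v : marked n, (0 < v) && ~~ side S o v]) => //.
  move=> /existsPn all; case: nfan; apply/setP => g; rewrite inE.
  have so (v : marked n) : 0 < v -> side S o v.
    by move=> v0; have := all v; rewrite v0 negbK.
  have gj := joins_val g; have lg := arc_lt g.
  apply/idP/eqP => [gS | g0].
    apply/eqP/contraT; rewrite -lt0n => g0.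
    have lt1 : (val g).1.+1 < (val g).2.
      rewrite ltn_neqAle lg andbT; apply/eqP => e.
      by have := seg_joins g (seg_succ (esym e)); rewrite gj.
    have lt3 := ltn_trans lt1 (ltn_ord _).
    have := side_cross triS (so (Ordinal lt3) isT) _.
    move=> /(_ (val g).1 (val g).2); rewrite (side_arc S gj) gS => /(_ isT).
    by rewrite crossE //= g0 lt1 ltnSn.
  have eo : (val g).1 = o by apply: val_inj.
  have := so (val g).2; rewrite -(side_arc S gj) eo => -> //.
  by apply: leq_ltn_trans lg.
case: (@arg_minnP _ v0 (fun v : marked n => (0 < v) && ~~ side S o v) val v0P) => v.
move=> /andP[v_gt0 nov] min_v.
have v_gt1 : 1 < v.
  by case: v v_gt0 nov {min_v} => -[|[|m]] vn //= _; rewrite /side seg_succ.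
have lt_j : v.-1 < n.+3 by have := ltn_ord v; lia.
pose j : marked n := Ordinal lt_j.
have soj : side S o j.
  apply/contraT => nj; have := min_v j; rewrite nj andbT /= => /(_ _).
  by have -> : 0 < v.-1; [lia | move/(_ isT); lia].
have jvo : cyc j v o by rewrite /cyc /=; lia.
have sjo : side S j o by rewrite sideC.
have [p [jpo sjp spo]] := third_vertex triS sjo jvo.
have pv : v < p.
  have pv : p != v by apply: contraNneq nov => <-; rewrite sideC.
  by move: jpo pv; rewrite -val_eqE /cyc /=; lia.
have jvp : cyc j v p by rewrite /cyc /= pv ltn_predL v_gt0.
have [q [jqp sjq sqp]] := third_vertex triS sjp jvp.
have Q : quad S j q p o by rewrite /quad jqp -(cyc_rot j) jpo sjq sqp spo.
have lt_p := ltn_ord p.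
have jq : j < q < p by apply: cyc_between jqp; apply: leq_ltn_trans pv; apply: leq_pred.
have [g gS gj] : exists2 g, g \in S & joins g j p.
  case/sideP: sjp => // sg; exfalso; move: sg; rewrite seg_lt; last first.
    by apply: leq_ltn_trans pv; apply: leq_pred.
  rewrite /boundary_segment /=; move: (nat_of_ord v) (nat_of_ord p) v_gt1 pv.
  by clear; lia.
have [h hj] : exists h, joins h q o.
  have q_gt1 : 1 < q by case/andP: jq => /= jq _; apply: leq_ltn_trans jq; rewrite -subn1 subn_gt0.
  have q_lt : q < n.+2 by case/andP: jq => _ jq; apply: leq_trans jq _.
  have oq : o < q by exact: ltnW q_gt1.
  apply: exists_arc; first by rewrite eq_sym; apply: contraTneq oq => <-; rewrite ltnn.
  rewrite segC (seg_lt oq) /boundary_segment /= negb_or.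
  by rewrite (gtn_eqF q_gt1) (ltn_eqF q_lt).
exists g, h; split.
- exact: gS.
- exact: flip_new triS gS gj hj Q.
- exact: flip_triangulation triS gj hj Q.
rewrite /apex_degree; apply: proper_card; apply/properP; split.
  apply/subsetP => u; rewrite !inE side_flip => ->; rewrite /=.
  apply/orP; left; apply/negP => /(joins_eq gj) [] [e1 e2].
    by move: v_gt1; rewrite -subn_gt0 subn1 e1.
  by move: pv; rewrite e2.
exists q; first by rewrite inE side_flip [joins h _ _]joinsC hj orbT.
rewrite inE; apply/negP => soq; have := side_cross triS soq sjp.
have [jq1 jq2] := andP jq; rewrite crossE /=; last first.
- exact: leq_ltn_trans (leq_pred _) pv.
- exact: leq_ltn_trans (leq0n _) jq1.
by rewrite jq1 jq2 -[X in X && _]subn_gt0 subn0 -subn1 subn_gt0 v_gt1.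
Qed.

End FlipConnectivity.

(** * Flip connectivity *)

Section LabelledFlips.

Variable n : nat.
Implicit Types (g h : polygon_arc n) (k : 'I_n).
Implicit Types (S : {set polygon_arc n}) (T U : {ffun 'I_n -> polygon_arc n}).

Definition arcs T : {set polygon_arc n} := [set T i | i : 'I_n].

Lemma mem_arcs T i : T i \in arcs T.
Proof. exact: imset_f. Qed.

Lemma arcs_flip k T U : labelled_triangulation T -> is_flip k T U ->
  arcs U = U k |: arcs T :\ T k.
Proof.
move=> [injT _] [_ eqU]; apply/setP => g; rewrite !inE.
apply/imsetP/orP => [[i _ ->]|[/eqP ->|/andP[gk /imsetP[i _ eg]]]].
- case: (eqVneq i k) => [-> |ik]; [by left | right].
  by rewrite eqU // mem_arcs (inj_eq injT) ik.
- by exists k.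
- exists i => //; rewrite eqU ?eg //.
  by apply: contraNneq gk => <-; rewrite eg.
Qed.

Lemma labelled_flip k T h : labelled_triangulation T -> h \notin arcs T ->
  triangulation (h |: arcs T :\ T k) ->
  exists U, [/\ labelled_triangulation U, is_flip k T U & U k = h].
Proof.
move=> labT hT triU; pose U := [ffun i => if i == k then h else T i].
have flipU : is_flip k T U.
  split; first by rewrite ffunE eqxx; apply: contraNneq hT => ->; apply: mem_arcs.
  by move=> i ik; rewrite ffunE (negbTE ik).
have Uk : U k = h by rewrite ffunE eqxx.
exists U; split=> //; split; last by rewrite -/(arcs U) (arcs_flip labT flipU) Uk.
have [injT _] := labT; move=> i j; rewrite !ffunE.
case: eqP => [->|_]; case: eqP => [->|_] //; last exact: injT.
  by move=> e; move: hT; rewrite e mem_arcs.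
by move=> e; move: hT; rewrite -e mem_arcs.
Qed.

Lemma is_flip_sym k T U : is_flip k T U -> is_flip k U T.
Proof.
case=> neq eqU; split; first by rewrite eq_sym.
by move=> i ik; rewrite eqU.
Qed.

Lemma exists_labelled_flip k T : labelled_triangulation T ->
  exists2 U, labelled_triangulation U & is_flip k T U.
Proof.
move=> labT; have [_ triT] := labT.
have [h hT triU] := exists_flip triT (mem_arcs T k).
by have [U [labU flipU _]] := labelled_flip labT hT triU; exists U.
Qed.

Inductive flip_path : seq 'I_n -> {ffun 'I_n -> polygon_arc n} ->
    {ffun 'I_n -> polygon_arc n} -> Prop :=
| flip_nil T of labelled_triangulation T : flip_path [::] T T
| flip_cons k ks T U W of labelled_triangulation T & is_flip k T U
    & flip_path ks U W : flip_path (k :: ks) T W.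

Lemma flip_path_source ks T U : flip_path ks T U -> labelled_triangulation T.
Proof. by case. Qed.

Lemma flip_path_target ks T U : flip_path ks T U -> labelled_triangulation U.
Proof. by elim. Qed.

Lemma flip_path_rcons k ks T U W : flip_path ks T U -> is_flip k U W ->
  labelled_triangulation W -> flip_path (rcons ks k) T W.
Proof.
move=> + + labW; elim=> {ks T U} [T labT flipW | k' ks T T' U labT flipT' _ IH flipW].
  exact: flip_cons flipW (flip_nil labW).
by apply: flip_cons flipT' (IH flipW).
Qed.

Lemma flip_path_rev ks T U : flip_path ks T U -> flip_path (rev ks) U T.
Proof.
elim=> {ks T U} [T labT|k ks T T' U labT flipT' _ IH]; first exact: flip_nil.
by rewrite rev_cons; apply: flip_path_rcons IH (is_flip_sym flipT') labT.
Qed.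

Lemma flip_path_cat ks ks' T U W : flip_path ks T U -> flip_path ks' U W ->
  flip_path (ks ++ ks') T W.
Proof.
elim=> {ks T U} [//|k ks T T' U labT flipT' _ IH pathW].
exact: flip_cons flipT' (IH pathW).
Qed.

Lemma apex_degree_max S : apex_degree S <= n.+3.
Proof. by rewrite -[n.+3]card_ord; apply: max_card. Qed.

Lemma fan_path T : labelled_triangulation T ->
  exists ks U, flip_path ks T U /\ arcs U = fan n.
Proof.
have [d] := ubnP (n.+3 - apex_degree (arcs T)); elim: d T => // d IH T lt_d labT.
case: (eqVneq (arcs T) (fan n)) => [eT | /eqP neT].
  by exists [::], T; split=> //; apply: flip_nil.
have [_ triT] := labT; have [g [h [gT hT triU deg]]] := flip_towards_fan triT neT.
have [k _ eg] := imsetP gT; rewrite eg in triU deg.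
have [U [labU flipU Uk]] := labelled_flip labT hT triU.
have eU := arcs_flip labT flipU; rewrite Uk in eU.
have [|ks [W [pathW eW]]] := IH U _ labU.
  have := apex_degree_max (arcs U); rewrite eU; move: lt_d deg.
  move: (apex_degree _) (apex_degree _) => x y. by clear; lia.
by exists (k :: ks), W; split=> //; apply: flip_cons flipU pathW.
Qed.

Lemma path_from_fan T S : labelled_triangulation T -> arcs T = fan n ->
  triangulation S -> exists ks U, flip_path ks T U /\ arcs U = S.
Proof.
move=> labT eT; have [d] := ubnP (n.+3 - apex_degree S).
elim: d S => // d IH S lt_d triS.
case: (eqVneq S (fan n)) => [-> | /eqP neS].
  by exists [::], T; split=> //; apply: flip_nil.
have [g [h [gS hS triS' deg]]] := flip_towards_fan triS neS.
have [|ks [U [pathU eU]]] := IH _ _ triS'.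
  by have := apex_degree_max (h |: S :\ g); move: lt_d deg; clear; lia.
have labU := flip_path_target pathU.
have [k _ eh] : exists2 k, k \in 'I_n & h = U k.
  by apply/imsetP; rewrite -/(arcs U) eU setU11.
have gh : g != h by apply: contraNneq hS => <-.
have gU : g \notin arcs U by rewrite eU !inE eqxx (negbTE gh).
have eS : g |: arcs U :\ U k = S.
  by rewrite eU -eh setU1K ?setD1K // !inE (negbTE hS) andbF.
have triW : triangulation (g |: arcs U :\ U k) by rewrite eS.
have [W [labW flipW Wk]] := labelled_flip labU gU triW.
exists (rcons ks k), W; split; first exact: flip_path_rcons pathU flipW labW.
by rewrite (arcs_flip labU flipW) Wk.
Qed.

(** Both triangulations are related by flips to the one all of whose arcs end at
    the vertex 0. *)
Lemma flip_connected T S : labelled_triangulation T -> triangulation S ->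
  exists ks U, flip_path ks T U /\ arcs U = S.
Proof.
move=> labT triS; have [ks [U [pathU eU]]] := fan_path labT.
have [ks' [W [pathW eW]]] := path_from_fan (flip_path_target pathU) eU triS.
by exists (ks ++ ks'), W; split=> //; apply: flip_path_cat pathW.
Qed.

Lemma extend_triangulation S : (forall g h, g \in S -> h \in S -> ~~ crossing g h) ->
  exists2 S', triangulation S' & S \subset S'.
Proof.
move=> nc; have [|S' triS' sub] := @maxset_exists _
    (fun X : {set polygon_arc n} => [forall g in X, forall h in X, compatible g h]) S;
  last by exists S'.
by apply/forall_inP => g gS; apply/forall_inP => h; apply: nc.
Qed.

End LabelledFlips.

(** * The quiver of a triangulation *)

Lemma cyc_asym (a b c : nat) : cyc a b c -> cyc c b a = false.
Proof. by move=> c1; apply/negbTE; move: c1; order_tac [:: a; b; c]. Qed.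

Section Arrows.

Variable n : nat.
Implicit Types (a b p q r s u v w : marked n) (g h x y : polygon_arc n).
Implicit Types (S : {set polygon_arc n}) (T U : {ffun 'I_n -> polygon_arc n}).

Lemma joins_lt g u v : joins g u v -> u < v -> val g = (u, v).
Proof.
case/orP => /eqP // e uv; have := arc_lt g.
by rewrite e /= => /(ltn_trans uv); rewrite ltnn.
Qed.

Lemma is_sideE S u v : u < v -> is_side S (u, v) = side S u v.
Proof.
move=> uv; rewrite /is_side /side (seg_lt uv); congr (_ || _).
apply: eq_existsb => g; congr (_ && _); rewrite /joins; case: eqP => // _.
by apply/esym/negbTE/eqP => e; have := arc_lt g; rewrite e /= ltnNge ltnW.
Qed.

Definition turn g h u v w : bool := [&& joins g u v, joins h v w & cyc u v w].

(** The arrows of the quiver of a triangulation, in a form that does not depend on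
    where the numbering of the vertices starts. *)
Definition arrow S g h : bool :=
  [exists u, exists v, exists w, turn g h u v w && side S u w].

Lemma arrowP S g h :
  reflect (exists u v w, turn g h u v w /\ side S u w) (arrow S g h).
Proof.
apply: (iffP existsP) => [[u /existsP[v /existsP[w /andP[t s]]]] | [u [v [w [t s]]]]].
  by exists u, v, w.
by exists u; apply/existsP; exists v; apply/existsP; exists w; rewrite t.
Qed.

Lemma turn_uniq g h u v w u' v' w' : turn g h u v w -> turn g h u' v' w' ->
  [/\ u = u', v = v' & w = w'].
Proof.
case/and3P=> gj hj /cyc_ord_neq[uv vw uw] /and3P[gj' hj' /cyc_ord_neq[uv' vw' uw']].
case: (joins_eq gj gj') => -[e1 e2]; case: (joins_eq hj hj') => -[e3 e4]; subst => //;
  by move: uv vw uw uv' vw' uw'; rewrite ?eqxx.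
Qed.

Lemma turn_asym g h u v w u' v' w' : turn g h u v w -> ~~ turn h g u' v' w'.
Proof.
case/and3P=> gj hj c; have [uv vw uw] := cyc_ord_neq c.
apply/negP=> /and3P[hj' gj' c']; have [uv' vw' uw'] := cyc_ord_neq c'.
have no := cyc_asym c.
by case: (joins_eq gj gj') => -[e1 e2]; case: (joins_eq hj hj') => -[e3 e4]; subst => //;
  move: uv vw uw uv' vw' uw' c c'; rewrite ?eqxx ?no.
Qed.

Lemma arrow_turn S g h u v w : turn g h u v w -> arrow S g h = side S u w.
Proof.
move=> t; apply/arrowP/idP => [[u' [v' [w' [t' s]]]]|s].
  by have [-> _ ->] := turn_uniq t t'.
by exists u, v, w.
Qed.

Lemma arrow_back S g h u v w : turn g h u v w -> arrow S h g = false.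
Proof.
move=> t; apply/idP => /arrowP[u' [v' [w' [t' _]]]].
by have := turn_asym u' v' w' t; rewrite t'.
Qed.

Lemma arrow_asym S g h : arrow S g h -> arrow S h g = false.
Proof. by case/arrowP=> u [v [w [t _]]]; apply: arrow_back t. Qed.

Lemma arrow_irr S g : arrow S g g = false.
Proof. by apply/idP => ar; have := arrow_asym ar; rewrite ar. Qed.

Lemma follows_uniq S g h t t' : triangle S t -> triangle S t' ->
  follows_clockwise t g h -> follows_clockwise t' g h -> t = t'.
Proof.
case: t t' => [[a b] c] [[a' b'] c'] /and5P[ab bc _ _ _] /and5P[ab' bc' _ _ _].
rewrite /follows_clockwise; case/or3P=> /andP[/eqP -> /eqP ->];
  case/or3P=> /andP[/eqP[e1 e2] /eqP[e3 e4]]; subst=> //;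
  move: ab bc ab' bc'; clear; lia.
Qed.

Lemma follows_turn S a b c g h : triangle S (a, b, c) ->
  follows_clockwise (a, b, c) g h -> arrow S g h.
Proof.
case/and5P=> ab bc; have ac := ltn_trans ab bc.
rewrite !is_sideE // => sab sbc sac.
case/or3P=> /andP[/eqP eg /eqP eh]; apply/arrowP.
- by exists a, b, c; rewrite /turn /joins eg eh !eqxx /cyc ab bc.
- exists b, c, a; rewrite /turn /joins eg eh !eqxx ?orbT /cyc ab bc ?orbT.
  by rewrite sideC.
- by exists c, a, b; rewrite /turn /joins eg eh !eqxx ?orbT /cyc ab bc ?orbT sideC.
Qed.

Lemma triangle_arrowsE S g h : g \in S -> h \in S ->
  triangle_arrows S g h = arrow S g h.
Proof.
move=> gS hS; rewrite /triangle_arrows.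
have exT : arrow S g h -> exists t, triangle S t && follows_clockwise t g h.
  case/arrowP=> u [v [w [/and3P[gj hj c] s]]].
  have sg : side S u v by rewrite (side_arc S gj).
  have sh : side S v w by rewrite (side_arc S hj).
  case/or3P: c => /andP[lt1 lt2]; have lt3 := ltn_trans lt1 lt2.
  - exists (u, v, w); rewrite /triangle /= lt1 lt2 !is_sideE // sg sh s /=.
    by rewrite (joins_lt gj) // (joins_lt hj) // !eqxx.
  - exists (v, w, u); rewrite /triangle /= lt1 lt2 !is_sideE // sh.
    rewrite [side S w u]sideC s [side S v u]sideC sg /=.
    rewrite joinsC in gj; rewrite (joins_lt gj) // (joins_lt hj) // !eqxx.
    by rewrite !orbT.
  - exists (w, u, v); rewrite /triangle /= lt1 lt2 !is_sideE // sg.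
    rewrite [side S w u]sideC s [side S w v]sideC sh /=.
    rewrite joinsC in hj; rewrite (joins_lt gj) // (joins_lt hj) // !eqxx.
    by rewrite !orbT.
case: (boolP (arrow S g h)) => [/exT[t tP] | nar].
  rewrite (_ : [set _ | _] = [set t]) ?cards1 //; apply/setP => t'; rewrite !inE.
  apply/idP/eqP => [/andP[t1 t2]|-> //]; case/andP: tP => t3 t4.
  exact: follows_uniq t1 t3 t2 t4.
apply/eqP; rewrite cards_eq0; apply/eqP/setP => -[[a b] c]; rewrite !inE.
by apply: contraNF nar => /andP[]; apply: follows_turn.
Qed.

(** Two distinct arcs span at most one triangle, so at most one arrow joins them
    and there are no 2-cycles to delete. *)
Lemma triangulation_quiverE T i j : triangulation_quiver T i j = arrow (arcs T) (T i) (T j).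
Proof.
rewrite mxE !triangle_arrowsE ?mem_arcs //.
by case: (boolP (arrow _ _ _)) => [/arrow_asym -> | _]; rewrite ?sub0n.
Qed.

Section Diagonal.

Variables (S : {set polygon_arc n}) (g x : polygon_arc n) (a p b q : marked n).
Hypotheses (triS : triangulation S) (gj : joins g a b) (Q : quad S a p b q).
Hypothesis (xS : x \in S).

Lemma arrow_to_diagonal : arrow S x g = joins x p b || joins x q a.
Proof.
case/and5P: Q => apb bqa sap spb /andP[sbq sqa].
apply/arrowP/orP => [[u [v [w [/and3P[xj gj' c] suw]]]] | [xj|xj]].
- have suv : side S u v by rewrite (side_arc S xj).
  case: (joins_eq gj gj') => -[e1 e2]; subst v w; [right | left].
    have c' : cyc b u a by rewrite cyc_rot.
    have sbu : side S b u by rewrite sideC.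
    by rewrite (third_vertex_uniq triS bqa c' sbq sqa sbu suv).
  have c' : cyc a u b by rewrite cyc_rot.
  have sau : side S a u by rewrite sideC.
  by rewrite (third_vertex_uniq triS apb c' sap spb sau suv).
- exists p, b, a; rewrite /turn xj joinsC gj /= -cyc_rot; split=> //.
  by rewrite sideC.
- by exists q, a, b; rewrite /turn xj gj /= -cyc_rot bqa sideC.
Qed.

Lemma arrow_from_diagonal : arrow S g x = joins x a p || joins x b q.
Proof.
case/and5P: Q => apb bqa sap spb /andP[sbq sqa].
apply/arrowP/orP => [[u [v [w [/and3P[gj' xj c] suw]]]] | [xj|xj]].
- have svw : side S v w by rewrite (side_arc S xj).
  case: (joins_eq gj gj') => -[e1 e2]; subst u v; [right | left].
    have c' : cyc b w a by rewrite -cyc_rot.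
    have swa : side S w a by rewrite sideC.
    by rewrite (third_vertex_uniq triS bqa c' sbq sqa svw swa).
  have c' : cyc a w b by rewrite -cyc_rot.
  have swb : side S w b by rewrite sideC.
  by rewrite (third_vertex_uniq triS apb c' sap spb svw swb).
- exists b, a, p; rewrite /turn xj joinsC gj /= cyc_rot; split=> //.
  by rewrite sideC.
- by exists a, b, q; rewrite /turn xj gj /= cyc_rot bqa sideC.
Qed.

End Diagonal.

End Arrows.

(** * Flips are quiver mutations *)

Section FlipMutation.

Variable n : nat.
Implicit Types (a b p q r s u v w : marked n) (g h x y : polygon_arc n).
Implicit Types (S : {set polygon_arc n}) (T U : {ffun 'I_n -> polygon_arc n}).

Section ArrowFlip.

Variables (S : {set polygon_arc n}) (g h : polygon_arc n) (a p b q : marked n).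
Hypotheses (triS : triangulation S) (gS : g \in S).
Hypotheses (gj : joins g a b) (hj : joins h p q) (Q : quad S a p b q).

Let S' := h |: S :\ g.

(** The arrows into [g] come from two opposite sides of its quadrilateral and the
    arrows out of it go to the other two, so [x] and [y] share a vertex of the
    quadrilateral and their other ends are joined by a diagonal. *)
Lemma path_through_diagonal x y : x \in S -> y \in S -> arrow S x g -> arrow S g y ->
  exists u v w, (turn y x u v w /\ joins g u w) \/ (turn x y u v w /\ joins h u w).
Proof.
move=> xS yS; rewrite (arrow_to_diagonal triS gj Q xS) (arrow_from_diagonal triS gj Q yS).
case/and3P: (Q) => apb bqa _; have /andP[pbq qap] := quad_cyc apb bqa.
case/orP=> xj; case/orP=> yj.
- by exists a, p, b; left; rewrite /turn yj xj apb gj.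
- by exists p, b, q; right; rewrite /turn xj yj pbq hj.
- by exists q, a, p; right; rewrite /turn xj yj qap joinsC hj.
- by exists b, q, a; left; rewrite /turn yj xj bqa joinsC gj.
Qed.

(** In the quadrilateral around [g], the paths through [g] are those that a
    mutation at [g] completes or cancels, according to whether the third side of
    the triangle of [x] and [y] is the new diagonal [h] or the old one [g]. *)
Lemma path_through_diagonal_turn x y u v w : x \in S :\ g -> y \in S :\ g ->
  turn x y u v w ->
  (arrow S x g && arrow S g y = joins h u w) /\
  (arrow S y g && arrow S g x = joins g u w).
Proof.
move=> xS' yS' t; have [xj yj c] := and3P t.
have [_ xS] := setD1P xS'; have [_ yS] := setD1P yS'.
have suv : side S u v by rewrite (side_arc S xj).
have svw : side S v w by rewrite (side_arc S yj).
rewrite !(arrow_to_diagonal triS gj Q) // !(arrow_from_diagonal triS gj Q) //.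
case/and5P: (Q) => apb bqa sap spb /andP[sbq sqa].
split; apply/andP/idP => [[ar1 ar2]|].
- move: ar1 ar2; rewrite -(arrow_to_diagonal triS gj Q) // -(arrow_from_diagonal triS gj Q) //.
  move=> xg gy; have [u' [v' [w' [[t' _]|[t' hj']]]]] := path_through_diagonal xS yS xg gy.
    by have := turn_asym u' v' w' t; rewrite t'.
  by have [-> _ ->] := turn_uniq t t'.
- have triS' : triangulation S' := flip_triangulation triS gj hj Q.
  have /and5P[pbq qap spb' sbq' /andP[sqa' sap']] := quad_flip h gj Q.
  have suv' : side S' u v by rewrite (side_arc S' xj) in_setU xS' orbT.
  have svw' : side S' v w by rewrite (side_arc S' yj) in_setU yS' orbT.
  move=> hj'; case: (joins_eq hj hj') => -[e1 e2]; subst p q.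
    have -> : b = v := third_vertex_uniq triS' pbq c spb' sbq' suv' svw'.
    by rewrite xj yj ?orbT.
  have -> : a = v := third_vertex_uniq triS' qap c sqa' sap' suv' svw'.
  by rewrite xj yj ?orbT.
- move: ar1 ar2; rewrite -(arrow_to_diagonal triS gj Q) // -(arrow_from_diagonal triS gj Q) //.
  move=> yg gx; have [u' [v' [w' [[t' gj']|[t' _]]]]] := path_through_diagonal yS xS yg gx.
    by have [-> _ ->] := turn_uniq t t'.
  by have := turn_asym u' v' w' t; rewrite t'.
- move=> gj'; case: (joins_eq gj gj') => -[e1 e2]; subst a b.
    have -> : p = v := third_vertex_uniq triS apb c sap spb suv svw.
    by rewrite xj yj ?orbT.
  have -> : q = v := third_vertex_uniq triS bqa c sbq sqa suv svw.
  by rewrite xj yj ?orbT.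
Qed.

Lemma arrow_flip x y : x \in S :\ g -> y \in S :\ g ->
  arrow S' x y = ((arrow S x y + arrow S x g * arrow S g y)
                  - (arrow S y x + arrow S y g * arrow S g x))%N :> nat.
Proof.
move=> xS' yS'; rewrite !mulnb.
have [_ xS] := setD1P xS'; have [_ yS] := setD1P yS'.
have turns z1 z2 u v w : z1 \in S :\ g -> z2 \in S :\ g -> turn z1 z2 u v w ->
    [/\ arrow S' z1 z2 = (arrow S z1 z2 && ~~ joins g u w) || joins h u w,
        joins g u w ==> arrow S z1 z2 & ~~ (joins h u w && arrow S z1 z2)].
  move=> z1S z2S t; rewrite !(arrow_turn _ t) side_flip; split=> //.
    by apply/implyP => gj'; rewrite (side_arc S gj').
  apply/negP => /andP[hj']; rewrite (side_arc S hj') => hS.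
  by have := flip_new triS gS gj hj Q; rewrite hS.
case: (boolP [exists u, exists v, exists w, turn x y u v w]) =>
    [/existsP[u /existsP[v /existsP[w t]]] | no_xy].
  have [-> ->] := path_through_diagonal_turn xS' yS' t.
  have [-> i1 i2] := turns _ _ _ _ _ xS' yS' t; rewrite (arrow_back _ t).
  by move: i1 i2; case: (arrow S x y) (joins g u w) (joins h u w) => [] [] [].
case: (boolP [exists u, exists v, exists w, turn y x u v w]) =>
    [/existsP[u /existsP[v /existsP[w t]]] | no_yx].
  have [-> ->] := path_through_diagonal_turn yS' xS' t.
  have [_ i1 i2] := turns _ _ _ _ _ yS' xS' t; rewrite !(arrow_back _ t).
  by move: i1 i2; case: (arrow S y x) (joins g u w) (joins h u w) => [] [] [].
have noxy u v w : turn x y u v w = false.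
  by apply: contraNF no_xy => t; apply/existsP; exists u; apply/existsP; exists v;
     apply/existsP; exists w.
have noyx u v w : turn y x u v w = false.
  by apply: contraNF no_yx => t; apply/existsP; exists u; apply/existsP; exists v;
     apply/existsP; exists w.
have no S0 : (arrow S0 x y = false) * (arrow S0 y x = false).
  by split; apply/idP => /arrowP[u [v [w []]]]; rewrite ?noxy ?noyx.
rewrite !no; have -> : arrow S x g && arrow S g y = false; last by [].
apply/andP => -[xg gy].
by have [u [v [w [[]|[]]]]] := path_through_diagonal xS yS xg gy; rewrite ?noxy ?noyx.
Qed.

End ArrowFlip.

Lemma flip_data k T U : labelled_triangulation T -> labelled_triangulation U ->
  is_flip k T U -> exists a p b q,
    [/\ joins (T k) a b, joins (U k) p q & quad (arcs T) a p b q].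
Proof.
move=> labT labU flipU; have [_ triT] := labT; have [_ triU] := labU.
rewrite -/(arcs U) (arcs_flip labT flipU) in triU.
by apply: flip_quad triT triU (mem_arcs T k) _; case: flipU.
Qed.

Lemma quiver_flip k T U : labelled_triangulation T -> labelled_triangulation U ->
  is_flip k T U ->
  quiver_mutation k (triangulation_quiver T) = triangulation_quiver U.
Proof.
move=> labT labU flipU; have [a [p [b [q [gj hj Q]]]]] := flip_data labT labU flipU.
have [injT triT] := labT; have [_ triU] := labU; have [_ eqU] := flipU.
have eU := arcs_flip labT flipU; rewrite -!/(arcs _) in triT triU.
have QU : quad (arcs U) p b q a.
  by rewrite eU; apply: quad_flip _ gj Q.
have inT i : i != k -> T i \in arcs T :\ T k.
  by move=> ik; rewrite !inE mem_arcs (inj_eq injT) ik.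
apply/matrixP => i j; rewrite mxE !triangulation_quiverE.
case: (eqVneq i k) => [->|ik]; case: (eqVneq j k) => [->|jk] /=.
- by rewrite !arrow_irr.
- rewrite (arrow_to_diagonal triT gj Q) ?mem_arcs //.
  by rewrite (arrow_from_diagonal triU hj QU) ?mem_arcs // eqU.
- rewrite (arrow_from_diagonal triT gj Q) ?mem_arcs //.
  by rewrite (arrow_to_diagonal triU hj QU) ?mem_arcs // eqU // orbC.
- by rewrite !eqU // eU (arrow_flip triT (mem_arcs T k) gj hj Q) ?inT.
Qed.

End FlipMutation.

(** * Triangulations with a quiver of type A *)

Section NestedArcs.

Variables (m : nat) (eps : nat -> bool).
Let n := m.+1.
Implicit Types (i j k : nat).

Definition left_end i : nat := \sum_(i <= k < m) eps k.
Definition right_end i : nat := left_end i + i + 2.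

Lemma left_end_last : left_end m = 0.
Proof. by rewrite /left_end big_geq. Qed.

Lemma left_endS i : i < m -> left_end i = eps i + left_end i.+1.
Proof. by move=> im; rewrite /left_end big_ltn. Qed.

Lemma left_end_bounds i j : i <= j -> j <= m ->
  left_end j <= left_end i /\ left_end i + i <= left_end j + j.
Proof.
move=> ij jm; have [d ej] : exists d, j = i + d by exists (j - i); rewrite subnKC.
rewrite ej in jm *; clear ij ej j; elim: d i jm => [|d IH] i jm; first by rewrite addn0.
have im : i < m by move: jm; lia.
have [h1 h2] : left_end (i.+1 + d) <= left_end i.+1 /\
    left_end i.+1 + i.+1 <= left_end (i.+1 + d) + (i.+1 + d) by apply: IH; move: jm; lia.
rewrite (left_endS im) -addSnnS; move: h1 h2; case: (eps i) => /=.
  by move: (left_end _) (left_end _) => a b; lia.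
by move: (left_end _) (left_end _) => a b; lia.
Qed.

Lemma right_end_bounds i j : i <= j -> j <= m -> right_end i <= right_end j.
Proof. by move=> ij jm; have [_] := left_end_bounds ij jm; rewrite /right_end leq_add2r. Qed.

Lemma left_end_le i : i <= m -> left_end i <= m - i.
Proof.
by move=> im; have [_] := left_end_bounds im (leqnn m); rewrite left_end_last; lia.
Qed.

Lemma right_end_lt i : i <= m -> right_end i < n.+2.
Proof. by move=> im; have := left_end_le im; rewrite /right_end /n; lia. Qed.

Definition vertex i : marked n := inord i.

Lemma nested_arc_subproof (i : 'I_n) :
  let p := (vertex (left_end i), vertex (right_end i)) in
  (p.1 < p.2) && ~~ boundary_segment p.
Proof.
have im : i <= m by rewrite -ltnS.
have r := right_end_lt im; have l := left_end_le im.
rewrite /boundary_segment /= /vertex !inordK; try by move: l r; rewrite /n; lia.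
by move: l r; rewrite /right_end /n; lia.
Qed.

(** Consecutive arcs share one end, and the other end moves by one step to the
    left or to the right, as prescribed by [eps]. *)
Definition nested_arc (i : 'I_n) : polygon_arc n :=
  exist (fun p : marked n * marked n => is_true ((p.1 < p.2) && ~~ boundary_segment p)) _
    (nested_arc_subproof i).

Lemma vertexK i : i < n.+3 -> vertex i = i :> nat.
Proof. exact: inordK. Qed.

Lemma left_vertex (i : 'I_n) : (val (nested_arc i)).1 = left_end i :> nat.
Proof.
have im : i <= m by rewrite -ltnS.
by rewrite /= vertexK //; have := left_end_le im; rewrite /n; lia.
Qed.

Lemma right_vertex (i : 'I_n) : (val (nested_arc i)).2 = right_end i :> nat.
Proof.
have im : i <= m by rewrite -ltnS.
by rewrite /= vertexK //; have := right_end_lt im; lia.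
Qed.

Lemma nested_arc_crossing (i : 'I_n) (u v : marked n) : u < v ->
  cross (val (nested_arc i)).1 (val (nested_arc i)).2 u v =
  [&& left_end i < u, u < right_end i & right_end i < v] ||
  [&& u < left_end i, left_end i < v & v < right_end i].
Proof.
by move=> uv; rewrite crossE ?arc_lt // left_vertex right_vertex.
Qed.

Definition nested_arcs : {ffun 'I_n -> polygon_arc n} := [ffun i => nested_arc i].

(** Take the first of the nested arcs that encloses [u v].  The previous arc is
    one step shorter at one end and does not enclose [u v], so [u v] starts or
    stops where the arc does; without a crossing it is that arc. *)
Lemma uncrossed_nested u v : u.+1 < v -> v < n.+3 -> ~~ ((u == 0) && (v == n.+2)) ->
  (forall i, i <= m -> ~~ ([&& left_end i < u, u < right_end i & right_end i < v] ||
                          [&& u < left_end i, left_end i < v & v < right_end i])) ->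
  exists i, [/\ i <= m, u = left_end i & v = right_end i].
Proof.
move=> uv vn nseg nc.
have v_le : v < n.+2.
  have := nc m (leqnn m); rewrite /right_end left_end_last.
  by move: uv vn nseg; rewrite /n; clear; lia.
have fit : exists i, (i <= m) && ((left_end i <= u) && (v <= right_end i)).
  by exists m; rewrite leqnn /right_end left_end_last /=; move: v_le; rewrite /n; lia.
case: (ex_minnP fit) => i /andP[im /andP[lu vr]] min_i; exists i.
case: i im lu vr min_i => [|i] im lu vr min_i.
  by split=> //; move: lu vr uv; rewrite /right_end; clear; lia.
have im' : i < m by [].
have notfit : ~~ ((left_end i <= u) && (v <= right_end i)).
  by apply/negP => fit'; have := min_i i; rewrite (ltnW im) fit' ltnn => /(_ isT).
have eL := left_endS im'.
have [-> ->] : u = left_end i.+1 /\ v = right_end i.+1; last by [].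
move: notfit lu vr uv (nc i (ltnW im)); rewrite /right_end eL.
case: (eps i); move: (left_end i.+1) => a; clear; lia.
Qed.

Lemma nested_arc_of (i : nat) (g : polygon_arc n) : i <= m ->
  (val g).1 = left_end i :> nat -> (val g).2 = right_end i :> nat -> g \in arcs nested_arcs.
Proof.
move=> im e1 e2; have im' : i < n by [].
apply/imsetP; exists (Ordinal im') => //; rewrite ffunE; apply: val_inj.
rewrite [LHS]surjective_pairing [RHS]surjective_pairing; congr (_, _); apply: val_inj.
  by rewrite -[RHS]/(nat_of_ord _) left_vertex.
by rewrite -[RHS]/(nat_of_ord _) right_vertex.
Qed.

Lemma nested_arcs_labelled : labelled_triangulation nested_arcs.
Proof.
split=> [i j|].
  rewrite !ffunE => e; apply: val_inj => /=.
  have := left_vertex i; rewrite e left_vertex => eL.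
  have := right_vertex i; rewrite e right_vertex /right_end eL.
  by move=> /addIn /addnI.
apply/triangulationP; split.
  move=> _ _ /imsetP[i _ ->] /imsetP[j _ ->]; rewrite !ffunE.
  wlog le_ij : i j / i <= j => [th|].
    by case: (leqP i j) => [/th //|/ltnW/th]; rewrite crossingC.
  have jm : j <= m by rewrite -ltnS.
  rewrite crossingC (crossing_joins (joins_val _) (joins_val _)).
  rewrite nested_arc_crossing ?arc_lt // left_vertex right_vertex.
  have [h _] := left_end_bounds le_ij jm; have h' := right_end_bounds le_ij jm.
  by move: h h'; move: (left_end _) (left_end _) (right_end _) (right_end _) => a b c d; clear; lia.
move=> g nc; have lg := arc_lt g; have := valP g; rewrite lg /boundary_segment /=.
move=> /norP[nseg nseg0].
have [i [im e1 e2]] : exists i, [/\ i <= m, (val g).1 = left_end i :> nat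
    & (val g).2 = right_end i :> nat]; last exact: nested_arc_of im e1 e2.
apply: uncrossed_nested => // [|i im]; first by rewrite ltn_neqAle eq_sym nseg lg.
have im' : i < n by [].
rewrite -(@nested_arc_crossing (Ordinal im')) //.
rewrite -(crossing_joins (joins_val _) (joins_val g)) crossingC.
by apply: nc; apply/imsetP; exists (Ordinal im'); rewrite ?ffunE.
Qed.

Let S := arcs nested_arcs.

Lemma joins_nested (i : 'I_n) (u v : marked n) : joins (nested_arc i) u v ->
  (u = left_end i :> nat /\ v = right_end i :> nat) \/
  (v = left_end i :> nat /\ u = right_end i :> nat).
Proof.
have := left_vertex i; have := right_vertex i.
by rewrite /joins => eR eL /orP[] /eqP e; rewrite e /= in eR eL; [left | right].
Qed.

Lemma nested_arrow_forward (i j : 'I_n) : j = i.+1 :> nat -> eps i ->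
  arrow S (nested_arc i) (nested_arc j).
Proof.
move=> ij ei; have im : i < m by rewrite -ltnS -ij.
have eL : left_end i = (left_end j).+1 by rewrite ij (left_endS im) ei.
have eR : right_end i = right_end j by rewrite /right_end eL ij addSnnS.
have eV : (val (nested_arc i)).2 = (val (nested_arc j)).2.
  by apply: val_inj; rewrite -[LHS]/(nat_of_ord _) right_vertex eR -right_vertex.
apply/arrowP; exists (val (nested_arc i)).1, (val (nested_arc i)).2, (val (nested_arc j)).1.
split; last first.
  by apply/orP; left; rewrite segC; apply: seg_succ; rewrite !left_vertex.
have lt_i : left_end i < right_end i by rewrite -left_vertex -right_vertex arc_lt.
rewrite /turn; apply/and3P; split; [exact: joins_val | by rewrite eV joinsC joins_val |].
by rewrite /cyc !left_vertex right_vertex; move: eL lt_i; clear; lia.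
Qed.

Lemma nested_arrow_backward (i j : 'I_n) : j = i.+1 :> nat -> ~~ eps i ->
  arrow S (nested_arc j) (nested_arc i).
Proof.
move=> ij ei; have im : i < m by rewrite -ltnS -ij.
have eL : left_end i = left_end j by rewrite ij (left_endS im) (negbTE ei).
have eR : right_end j = (right_end i).+1 by rewrite /right_end eL ij !(addnS, addSn).
have eV : (val (nested_arc i)).1 = (val (nested_arc j)).1.
  by apply: val_inj; rewrite -[LHS]/(nat_of_ord (val (nested_arc i)).1) left_vertex eL -left_vertex.
apply/arrowP; exists (val (nested_arc j)).2, (val (nested_arc j)).1, (val (nested_arc i)).2.
split; last first.
  by apply/orP; left; rewrite segC; apply: seg_succ; rewrite !right_vertex.
have lt_i : left_end i < right_end i by rewrite -left_vertex -right_vertex arc_lt.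
rewrite /turn; apply/and3P; split; [by rewrite joinsC joins_val | by rewrite -eV joins_val |].
by rewrite /cyc left_vertex !right_vertex; move: eL eR lt_i; clear; lia.
Qed.

(** The third side of a triangle on two nonconsecutive arcs with a common end lies
    entirely to the left or to the right of the first nested arc, which all arcs
    enclose; so it is no arc, nor is it a boundary segment. *)
Lemma nested_side_adjacent (i j : 'I_n) (u v w : marked n) : i < j ->
  joins (nested_arc i) u v -> joins (nested_arc j) v w -> side S u w -> j = i.+1 :> nat.
Proof.
move=> ij /joins_nested ji /joins_nested jj suw.
have bnd k : k <= m -> [/\ left_end k <= left_end 0, right_end 0 <= right_end k & left_end k <= m].
  move=> km; have [h1 _] := left_end_bounds (leq0n k) km; have h2 := right_end_bounds (leq0n k) km.
  by split=> //; apply: leq_trans (left_end_le km) (leq_subr _ _).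
have jm : j <= m by rewrite -ltnS.
have im : i <= m by rewrite -ltnS.
have [L1 R1 M1] := bnd i im; have [L2 R2 _] := bnd j jm.
have [M _] := left_end_bounds (ltnW ij) jm.
have R0 : right_end 0 = left_end 0 + 2 by rewrite /right_end addn0.
case/sideP: suw => [|[_ /imsetP[k _ ->]]]; last first.
  rewrite ffunE => /joins_nested jk.
  have km : k <= m by rewrite -ltnS.
  have [L3 R3 _] := bnd k km.
  by move: ji jj jk R0 L1 R1 L2 R2 L3 R3; clear; lia.
rewrite /seg /boundary_segment /=.
by move: ji jj ij R0 L1 R1 M1 L2 R2 M; rewrite /right_end /n; clear; lia.
Qed.

End NestedArcs.

(** * Ptolemy's relation and exchange relations *)

Lemma linear_of_cyclic (a p b q : nat) : cyc a p b -> cyc b q a ->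
  [|| [&& a < p, p < b & b < q], [&& p < b, b < q & q < a],
      [&& b < q, q < a & a < p] | [&& q < a, a < p & p < b]].
Proof. by order_tac [:: a; p; b; q]. Qed.

Section Ptolemy.

Local Open Scope ring_scope.

Variables (F : fieldType) (n : nat).
Implicit Types (a b p q r s u v w : marked n) (g h : polygon_arc n).
Implicit Types (T U : {ffun 'I_n -> polygon_arc n}).

Definition ptolemaic (X : marked n -> marked n -> F) : Prop :=
  [/\ forall u v, X u v = X v u, forall u v, seg u v -> X u v = 1
    & forall a p b q, cyc a p b -> cyc b q a ->
        X a b * X p q = X p b * X q a + X a p * X b q].

Definition arc_value (X : marked n -> marked n -> F) g : F := X (val g).1 (val g).2.

Section Exchange.

Variable X : marked n -> marked n -> F.
Hypothesis ptX : ptolemaic X.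

Lemma arc_value_joins g u v : joins g u v -> arc_value X g = X u v.
Proof.
have [XC _ _] := ptX; rewrite /arc_value.
by case/orP=> /eqP -> //=; rewrite XC.
Qed.

Lemma prod_joins u v : u != v -> \prod_g arc_value X g ^+ joins g u v = X u v.
Proof.
have [_ X1 _] := ptX; move=> neq; case: (boolP (seg u v)) => [sg | nsg].
  rewrite big1 ?X1 // => g _; by rewrite (negbTE (seg_joins g sg)).
have [g gj] := exists_arc neq nsg; rewrite (bigD1 g) //= gj expr1 big1.
  by rewrite mulr1; apply: arc_value_joins.
by move=> h hg; case: (boolP (joins h u v)) => // /joins_inj/(_ gj) e; rewrite e eqxx in hg.
Qed.

Lemma prod_side_pair T u v r s : injective T ->
  side (arcs T) u v -> side (arcs T) r s -> (forall g, ~~ (joins g u v && joins g r s)) ->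
  \prod_i arc_value X (T i) ^+ (joins (T i) u v || joins (T i) r s) = X u v * X r s.
Proof.
move=> injT suv srs dis.
have prodE u' v' : side (arcs T) u' v' ->
    \prod_i arc_value X (T i) ^+ joins (T i) u' v' = X u' v'.
  move=> s'; rewrite -(prod_joins (side_neq s')).
  rewrite [RHS](bigID [in arcs T]) /= [X in _ * X]big1 ?mulr1; last first.
    by move=> g gT; case: (boolP (joins g _ _)) => // gj; rewrite -(side_arc _ gj) s' in gT.
  by rewrite /arcs big_imset //=; move=> i j _ _; apply: injT.
rewrite -(prodE _ _ suv) -(prodE _ _ srs) -big_split /=; apply: eq_bigr => i _.
rewrite -exprD; congr (_ ^+ _); have := dis (T i).
by case: (joins _ u v); case: (joins _ r s).
Qed.

(** The arrows into the flipped arc come from two opposite sides of its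
    quadrilateral and the arrows out of it go to the other two, so Ptolemy's
    relation for the two diagonals is the exchange relation. *)
Lemma seed_flip k T U : labelled_triangulation T -> labelled_triangulation U ->
  is_flip k T U -> arc_value X (T k) != 0 ->
  seed_mutation k (polygon_seed (arc_value X) T) = polygon_seed (arc_value X) U.
Proof.
move=> labT labU flipU nz; have [_ _ XP] := ptX.
rewrite /seed_mutation /polygon_seed /= (quiver_flip labT labU flipU); congr (_, _).
have [a [p [b [q [gj hj Q]]]]] := flip_data labT labU flipU.
have [injT triT] := labT; have [_ eqU] := flipU; rewrite -/(arcs T) in triT.
have /and5P[apb bqa sap spb /andP[sbq sqa]] := Q.
have [apn pbn abn] := cyc_ord_neq apb; have [bqn qan _] := cyc_ord_neq bqa.
have pqn := quad_neq Q.
apply/ffunP => i; rewrite !ffunE; case: eqP => [->|/eqP ik]; last by rewrite eqU.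
rewrite /exchange /= ffunE; apply: (canLR (mulfK nz)).
rewrite (arc_value_joins hj) mulrC [X in X * _](arc_value_joins gj) (XP _ _ _ _ apb bqa).
congr (_ + _).
  rewrite -(prod_side_pair injT spb sqa); last first.
    move=> g; apply/negP => /andP[gj1 gj2].
    by case: (joins_eq gj1 gj2) => -[e1 e2]; subst; move: apn pbn abn bqn qan pqn; rewrite ?eqxx.
  apply: eq_bigr => j _; rewrite ffunE triangulation_quiverE.
  by rewrite (arrow_to_diagonal triT gj Q) ?mem_arcs.
rewrite -(prod_side_pair injT sap sbq); last first.
  move=> g; apply/negP => /andP[gj1 gj2].
  by case: (joins_eq gj1 gj2) => -[e1 e2]; subst; move: apn pbn abn bqn qan pqn; rewrite ?eqxx.
apply: eq_bigr => j _; rewrite ffunE triangulation_quiverE.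
by rewrite (arrow_from_diagonal triT gj Q) ?mem_arcs.
Qed.

End Exchange.

Section FanValues.

Variable y : nat -> F.
Hypotheses (y_nz : forall j, y j != 0) (y_first : y 1 = 1) (y_last : y n.+2 = 1).

Let b j := \sum_(1 <= k < j) (y k * y k.+1)^-1.
Let s j := if j == 0%N then 0 else y j.
Let t j := if j == 0%N then -1 else y j * b j.
Let det i j := s i * t j - t i * s j.

(** With the values [y j] on the chords from the vertex 0, the points
    [(y j, y j * b j)] and [(0, -1)] of the plane have consecutive determinants
    1, and the determinants of pairs of points satisfy Ptolemy's relation. *)
Definition fan_value (u v : marked n) : F := if (u < v)%N then det u v else det v u.

Lemma fan_valueC u v : fan_value u v = fan_value v u.
Proof.
rewrite /fan_value; case: ltngtP => // /val_inj e; by rewrite e.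
Qed.

Lemma fan_value_apex v : (0 < v)%N -> fan_value ord0 v = y v.
Proof.
by move=> v0; rewrite /fan_value /= v0 /det /s /t /= eqn0Ngt v0 /= mul0r mulN1r opprK add0r.
Qed.

Lemma fan_ptolemaic : ptolemaic fan_value.
Proof.
split=> [| u v | a p b' q]; first exact: fan_valueC.
- wlog lt_uv : u v / (u < v)%N => [th sg|].
    have := seg_neq sg; rewrite -val_eqE /=; case: ltngtP => // lt _.
      exact: th.
    by rewrite fan_valueC; apply: th; rewrite // segC.
  rewrite (seg_lt lt_uv) /boundary_segment /=.
  case: (posnP u) => [u0 | u_gt0].
    have eu : u = ord0 by apply: val_inj.
    rewrite eu in lt_uv *; rewrite fan_value_apex //= => /orP[] /eqP ->.
      exact: y_first.
    exact: y_last.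
  case/orP => [/eqP ev|//].
  rewrite /fan_value lt_uv ev.
  rewrite /det /s /t /= eqn0Ngt u_gt0 /= /b big_nat_recr //=.
  move: (\sum_(1 <= k < u) _) => B; field; by rewrite !y_nz.
- have lin (i j k l : marked n) : (i < j)%N -> (j < k)%N -> (k < l)%N ->
    fan_value i k * fan_value j l =
    fan_value i j * fan_value k l + fan_value j k * fan_value i l.
    move=> ij jk kl; have ik := ltn_trans ij jk; have jl := ltn_trans jk kl.
    rewrite /fan_value ij jk kl ik jl (ltn_trans ik kl) /det; ring.
  move=> apb bqa; have := linear_of_cyclic apb bqa; case/or4P=> /and3P[l1 l2 l3].
  + by rewrite (lin a p b' q) // (fan_valueC q a); ring.
  + by rewrite mulrC (fan_valueC a b') (lin p b' q a) // (fan_valueC a p); ring.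
  + by rewrite (fan_valueC a b') (fan_valueC p q) (lin b' q a p) // (fan_valueC p b'); ring.
  + by rewrite mulrC (fan_valueC p q) (lin q a p b') // (fan_valueC b' q); ring.
Qed.

End FanValues.

(** The values [y j] on the chords from the vertex 0 are those of [c] on the arcs
    and 1, as an empty product, on the two boundary segments. *)
Lemma exists_ptolemaic T (c : 'I_n -> F) : labelled_triangulation T -> arcs T = fan n ->
  (forall i, c i != 0) ->
  exists2 X, ptolemaic X & forall i, arc_value X (T i) = c i.
Proof.
move=> [injT _] eT c_nz.
pose y j : F := \prod_(i | joins (T i) ord0 (inord j : marked n)) c i.
have y_nz j : y j != 0 by apply/prodf_neq0 => i _.
have y1 (j : nat) : seg (ord0 : marked n) (inord j) -> y j = 1.
  by move=> sg; rewrite /y big1 // => i ij; have := seg_joins (T i) sg; rewrite ij.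
have y_first : y 1%N = 1 by apply: y1; rewrite /seg /boundary_segment /= inordK.
have y_last : y n.+2 = 1.
  by apply: y1; rewrite /seg /boundary_segment /= inordK // eqxx orbT.
exists (fan_value y); first exact: fan_ptolemaic.
move=> i; have Ti := mem_arcs T i; rewrite eT inE in Ti.
have j := joins_val (T i); have lt_i := arc_lt (T i).
have e0 : (val (T i)).1 = ord0 by apply/val_inj/eqP.
rewrite /arc_value e0 in j lt_i *; rewrite fan_value_apex // /y inord_val.
rewrite (bigD1 i) //= big1 ?mulr1 // => i' /andP[j' ii'].
by rewrite (injT _ _ (joins_inj j' j)) eqxx in ii'.
Qed.

End Ptolemy.

(** * Algebraic independence and mutation *)

Section Independence.

Local Open Scope ring_scope.

Variables (F : fieldType) (iota : {rmorphism rat -> F}) (n : nat).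
Implicit Types (z c : 'I_n -> F) (e : {ffun 'I_n -> int}) (k : 'I_n).

Lemma absz_shift (a : int) (N : nat) : (`|a| <= N)%N -> Posz `|(a + N%:Z)%R|%N = a + N%:Z.
Proof. by move=> aN; rewrite gez0_abs //; lia. Qed.

Definition independent c : Prop := forall p : {mpoly rat[n]}, mmap iota c p = 0 -> p = 0.

Lemma independent_neq0 c i : independent c -> c i != 0.
Proof.
move=> ind; apply/eqP => ci; have : ('X_i : {mpoly rat[n]}) = 0.
  by apply: ind; rewrite mmapX mmap1U.
by move/(congr1 (mcoeff U_(i))); rewrite mcoeffXU eqxx mcoeff0 => /eqP; rewrite oner_eq0.
Qed.

Definition binomial_poly (d d' : 'I_n -> nat) : {mpoly rat[n]} :=
  'X_[[multinom d i | i < n]] + 'X_[[multinom d' i | i < n]].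

Definition binomial_value (d d' : 'I_n -> nat) c : F :=
  \prod_i c i ^+ d i + \prod_i c i ^+ d' i.

Lemma mmap_binomial d d' c : mmap iota c (binomial_poly d d') = binomial_value d d' c.
Proof.
rewrite /binomial_poly /binomial_value rmorphD /= !mmapX /mmap1.
by congr (_ + _); apply: eq_bigr => i _; rewrite mnmE.
Qed.

Lemma binomial_neq0 d d' c : independent c -> binomial_value d d' c != 0.
Proof.
move=> ind; apply/eqP; rewrite -mmap_binomial => /ind.
move/(congr1 (mcoeff [multinom d i | i < n])).
rewrite /binomial_poly mcoeffD !mcoeffX eqxx mcoeff0.
by case: (_ == _).
Qed.

(** For points [z] and [z'] that agree away from [k] and satisfy
    [z k * z' k = M z] for a binomial [M], a value at [z'] of a polynomial of
    degree at most [D] in the variable [k] becomes, after multiplication by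
    [z k ^+ D], a polynomial value at [z].  If [M] does not involve the variable
    [k], the relation between [z] and [z'] is symmetric. *)
Lemma exchange_poly k (d d' : 'I_n -> nat) (p : {mpoly rat[n]}) :
  exists D (q : {mpoly rat[n]}), forall z z', (forall i, i != k -> z' i = z i) ->
    z k * z' k = binomial_value d d' z ->
    mmap iota z q = z k ^+ D * mmap iota z' p.
Proof.
elim/mpolyind: p => [|a m p _ _ [D [q qP]]].
  by exists 0%N, 0 => z z' _ _; rewrite !rmorph0 mulr0.
(* the power of the variable [k] is absorbed by [z k * z' k = M z] *)
pose q0 : {mpoly rat[n]} := (\prod_(i | i != k) 'X_i ^+ m i) * binomial_poly d d' ^+ m k.
exists (m k + D)%N, (a *: q0 * 'X_k ^+ D + q * 'X_k ^+ m k) => z z' zz' zk.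
rewrite !rmorphD !rmorphM /= !rmorphXn /= (qP z z') // !mmapX !mmap1U !mmapZ.
rewrite rmorphM rmorphXn /= mmap_binomial -zk rmorph_prod /= mmapX /mmap1.
rewrite [\prod_(i < n) _](bigD1 k) //=.
have -> : \prod_(i < n | i != k) mmap iota z ('X_i ^+ m i)
        = \prod_(i < n | i != k) z' i ^+ m i.
  by apply: eq_bigr => i ik; rewrite rmorphXn /= mmapX mmap1U zz'.
rewrite exprMn exprD; ring.
Qed.

(** If [p] vanishes at [z'], its transform [q] vanishes at [z], hence is zero.  The
    roles of [z] and [z'] being symmetric, [p] then vanishes at [z]. *)
Lemma independent_exchange k (d d' : 'I_n -> nat) z z' : independent z ->
  d k = 0%N -> d' k = 0%N -> (forall i, i != k -> z' i = z i) ->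
  z k * z' k = binomial_value d d' z -> independent z'.
Proof.
move=> ind dk d'k zz' zk p p0.
have prod_eq (f : 'I_n -> nat) : f k = 0%N -> \prod_i z' i ^+ f i = \prod_i z i ^+ f i.
  move=> fk; apply: eq_bigr => i _; case: (eqVneq i k) => [->|ik]; last by rewrite zz'.
  by rewrite fk !expr0.
have [D [q qP]] := exchange_poly k d d' p.
have q0 : q = 0 by apply: ind; rewrite (qP z z') // p0 mulr0.
have zk' : z' k * z k = binomial_value d d' z'.
  by rewrite mulrC zk /binomial_value !prod_eq.
have zz'' i : i != k -> z i = z' i by move=> /zz' ->.
have z'k : z' k != 0.
  have := binomial_neq0 d d' ind; rewrite -zk mulf_eq0 negb_or => /andP[] //.
apply: ind; apply/eqP; have := qP z' z zz'' zk'; rewrite q0 rmorph0 => /esym/eqP.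
by rewrite mulf_eq0 expf_eq0 (negbTE z'k) andbF.
Qed.

(** * Laurent polynomials *)

Definition monomial c e : F := \prod_i c i ^ e i.

Definition laurent_value c (l : seq (int * {ffun 'I_n -> int})) : F :=
  \sum_(t <- l) t.1%:~R * monomial c t.2.

Definition laurent_coef e (l : seq (int * {ffun 'I_n -> int})) : int :=
  \sum_(t <- l | t.2 == e) t.1.

Lemma laurent_coef_eq0 c l e : independent c -> laurent_value c l = 0 ->
  laurent_coef e l = 0.
Proof.
move=> ind l0.
(* [c ^ N] clears the denominators of all terms and of the monomial of [e] *)
pose bound (f : {ffun 'I_n -> int}) := (\sum_i `|f i|)%N.
pose N := (bound e + \sum_(t <- l) bound t.2)%N.
have bound_le (f : {ffun 'I_n -> int}) i : (`|f i| <= bound f)%N.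
  by rewrite /bound (bigD1 i) //= leq_addr.
have Ne i : (`|e i| <= N)%N by apply: leq_trans (bound_le e i) _; apply: leq_addr.
have Nl t i : t \in l -> (`|t.2 i| <= N)%N.
  move=> tl; apply: leq_trans (bound_le t.2 i) _; apply: leq_trans (leq_addl _ _).
  by rewrite (big_rem t tl) /= leq_addr.
pose sh (f : {ffun 'I_n -> int}) : 'X_{1..n} := [multinom `|(f i + N%:Z)%R|%N | i < n].
have sh_inj (f f' : {ffun 'I_n -> int}) : (forall i, `|f i| <= N)%N ->
    (forall i, `|f' i| <= N)%N -> sh f = sh f' -> f = f'.
  move=> fN f'N efg; apply/ffunP => i; have /(congr1 (fun m : 'X_{1..n} => m i)) := efg.
  rewrite !mnmE => /(congr1 Posz); rewrite !absz_shift //; exact: addIr.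
pose p : {mpoly rat[n]} := \sum_(t <- l) t.1%:~R *: 'X_[sh t.2].
have shE (f : {ffun 'I_n -> int}) : (forall i, `|f i| <= N)%N ->
    mmap1 c (sh f) = monomial c f * \prod_i c i ^+ N.
  move=> fN; rewrite /mmap1 /monomial -big_split /=; apply: eq_bigr => i _.
  have nz := independent_neq0 i ind.
  rewrite -[c i ^+ N]/(c i ^ N%:Z) -expfzDr // mnmE.
  by rewrite -absz_shift.
have p0 : p = 0.
  apply: ind; rewrite /p rmorph_sum /= big_seq.
  rewrite (eq_bigr (fun t => t.1%:~R * monomial c t.2 * \prod_i c i ^+ N)).
    by rewrite -big_seq -mulr_suml -/(laurent_value c l) l0 mul0r.
  move=> t tl; rewrite mmapZ mmapX rmorph_int shE ?mulrA // => i; exact: Nl.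
have := congr1 (mcoeff (sh e)) p0; rewrite mcoeff0 /p raddf_sum /= => h.
apply: (@intr_inj rat); rewrite rmorph0 -[RHS]h /laurent_coef rmorph_sum /=.
rewrite big_mkcond /= !big_seq; apply: eq_bigr => t tl.
rewrite mcoeffZ mcoeffX; case: (eqVneq t.2 e) => [->|ne]; first by rewrite eqxx mulr1.
case: eqP => [/sh_inj h'|_]; last by rewrite mulr0.
by rewrite h' ?eqxx // in ne; move=> i; apply: Nl.
Qed.

End Independence.

(** * Seed mutation is an involution *)

Section SeedMutation.

Local Open Scope ring_scope.

Variables (F : fieldType) (iota : {rmorphism rat -> F}) (n : nat).
Implicit Types (Q : quiver n) (s : seed_data F n) (k : 'I_n).

Definition valid_seed s : Prop := no_loops_no_2cycles s.1 /\ independent iota s.2.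

Lemma quiver_mutation_valid k Q :
  no_loops_no_2cycles Q -> no_loops_no_2cycles (quiver_mutation k Q).
Proof.
case=> Q0 Q2; split=> [i|i j]; rewrite !mxE.
  by case: ifP => // _; rewrite subnn.
rewrite [(j == k) || _]orbC; case: ifP => [_|_]; first by case: (Q2 i j); [right|left].
by move: (Q i j + _)%N (Q j i + _)%N => a b; lia.
Qed.

Lemma quiver_mutationK k Q : no_loops_no_2cycles Q ->
  quiver_mutation k (quiver_mutation k Q) = Q.
Proof.
case=> Q0 Q2; apply/matrixP => i j; rewrite !mxE.
case: (eqVneq i k) => [->|ik] /=; first by rewrite ?eqxx ?orbT.
case: (eqVneq j k) => [->|jk] /=; first by rewrite ?eqxx ?orbT.
rewrite eqxx /=; have := Q2 i j.
by move: (Q i k * Q k j)%N (Q j k * Q k i)%N (Q i j) (Q j i)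
     (mulnC (Q k i) (Q j k)) (mulnC (Q k j) (Q i k)) => a b c d -> ->; lia.
Qed.

Lemma exchangeE k s : exchange k s =
  binomial_value (fun i => s.1 i k) (fun i => s.1 k i) s.2 / s.2 k.
Proof. by []. Qed.

Lemma seed_mutation_valid k s : valid_seed s -> valid_seed (seed_mutation k s).
Proof.
case=> Qs ind; split; first exact: quiver_mutation_valid.
apply: (@independent_exchange _ _ _ k (fun i => s.1 i k) (fun i => s.1 k i) s.2) => //.
- exact: (Qs.1 k).
- exact: (Qs.1 k).
- by move=> i ik; rewrite ffunE (negbTE ik).
by rewrite ffunE eqxx exchangeE mulrC divfK // (independent_neq0 _ ind).
Qed.

(** The numerator of the exchange does not involve the variable at [k], and
    reversing the arrows at [k] exchanges its two monomials. *)
Lemma seed_mutationK k s : valid_seed s -> seed_mutation k (seed_mutation k s) = s.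
Proof.
case: s => Q c [Qs ind]; rewrite /seed_mutation /= quiver_mutationK //; congr (_, _).
have Qkk : Q k k = 0%N by apply: Qs.1.
have prodE (f : 'I_n -> nat) z : f k = 0%N ->
    \prod_i [ffun i => if i == k then z else c i] i ^+ f i = \prod_i c i ^+ f i.
  move=> fk; apply: eq_bigr => i _; rewrite ffunE.
  by case: eqP => [->|//]; rewrite fk !expr0.
apply/ffunP => i; rewrite !ffunE; case: eqP => [->|//].
rewrite [LHS]exchangeE /binomial_value /= !prodE ?mxE ?eqxx //.
rewrite ffunE eqxx exchangeE /=.
have -> : \prod_i c i ^+ quiver_mutation k Q i k = \prod_i c i ^+ Q k i.
  by apply: eq_bigr => j _; rewrite mxE eqxx orbT.
have -> : \prod_i c i ^+ quiver_mutation k Q k i = \prod_i c i ^+ Q i k.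
  by apply: eq_bigr => j _; rewrite mxE eqxx.
rewrite [X in X / _]addrC -/(binomial_value (fun i => Q i k) (fun i => Q k i) c).
have nz := @binomial_neq0 _ _ _ (fun i => Q i k) (fun i => Q k i) _ ind.
by rewrite invf_div mulrC mulfVK.
Qed.

Lemma seed_mutations_valid ks s : valid_seed s -> valid_seed (seed_mutations ks s).
Proof.
by elim: ks s => // k ks IH s vs; apply: IH; apply: seed_mutation_valid.
Qed.

Lemma seed_mutations_cat ks ks' s :
  seed_mutations (ks ++ ks') s = seed_mutations ks' (seed_mutations ks s).
Proof. exact: foldl_cat. Qed.

Lemma seed_mutations_rev ks s : valid_seed s ->
  seed_mutations (rev ks) (seed_mutations ks s) = s.
Proof.
elim: ks s => // k ks IH s vs; rewrite rev_cons -cats1 seed_mutations_cat /=.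
by rewrite IH ?seed_mutationK //; apply: seed_mutation_valid.
Qed.

Lemma is_cluster_mutations ks s c : valid_seed s ->
  is_cluster (seed_mutations ks s) c <-> is_cluster s c.
Proof.
move=> vs; split=> -[ks' ->].
  by exists (ks ++ ks'); rewrite seed_mutations_cat.
by exists (rev ks ++ ks'); rewrite seed_mutations_cat seed_mutations_rev.
Qed.

Lemma independent_cluster s c : valid_seed s -> is_cluster s c -> independent iota c.
Proof. by move=> vs [ks ->]; case: (seed_mutations_valid ks vs). Qed.

Lemma seed_mutations_quiver ks s :
  (seed_mutations ks s).1 = quiver_mutations ks s.1.
Proof. by elim: ks s => // k ks IH s; rewrite /= IH. Qed.

End SeedMutation.

(** * Laurent expansions of arcs *)

Lemma cross_side_diagonal (a p b q r s : nat) : cyc a p b -> cyc b q a ->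
  ~~ cross r s p q ->
  [|| cross r s a p, cross r s p b, cross r s b q | cross r s q a] -> cross r s a b.
Proof. by order_tac [:: a; p; b; q; r; s]. Qed.

Lemma cross_endpoints (a b p q : nat) : cross a b p q ->
  [&& a != p, a != q, b != p & b != q].
Proof. by order_tac [:: a; b; p; q]. Qed.

Definition same_pair (r s a b : nat) : bool := (r == a) && (s == b) || (r == b) && (s == a).

Lemma cross_ptolemy (a p b q r s : nat) : cyc a p b -> cyc b q a ->
  (cross r s p b + cross r s q a + same_pair r s a b + same_pair r s p q <=
   cross r s a b + cross r s p q + same_pair r s p b + same_pair r s q a)%N.
Proof. by rewrite /same_pair; order_tac [:: a; p; b; q; r; s]. Qed.

Section Expansion.

Local Open Scope ring_scope.

Variables (F : fieldType) (n : nat) (J : Type) (c : 'I_n -> F) (d : J -> 'I_n -> int).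
Hypothesis c_nz : forall i, c i != 0.
Implicit Types (y z : F) (w : J -> int).

(** A Laurent polynomial in [c] with nonnegative coefficients all of whose
    monomials have degree at most [w j] for the grading where [c i] has degree
    [d j i], for all [j] at once. *)
Definition expands y w : Prop := exists l : seq (nat * {ffun 'I_n -> int}),
  y = \sum_(t <- l) t.1%:R * monomial c t.2 /\
  forall t, t \in l -> forall j, \sum_i t.2 i * d j i <= w j.

Lemma expands_le y w w' : (forall j, w j <= w' j) -> expands y w -> expands y w'.
Proof.
move=> le [l [yl dl]]; exists l; split=> // t tl j.
exact: le_trans (dl t tl j) (le j).
Qed.

Lemma expandsD y z w : expands y w -> expands z w -> expands (y + z) w.
Proof.
move=> [l [-> dl]] [l' [-> dl']]; exists (l ++ l'); rewrite big_cat; split=> // t.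
by rewrite mem_cat => /orP[/dl|/dl'].
Qed.

Lemma monomialM (e e' : {ffun 'I_n -> int}) :
  monomial c [ffun i => e i + e' i] = monomial c e * monomial c e'.
Proof.
by rewrite /monomial -big_split; apply: eq_bigr => i _; rewrite ffunE expfzDr.
Qed.

Lemma expandsM y z w w' : expands y w -> expands z w' ->
  expands (y * z) (fun j => w j + w' j).
Proof.
move=> [l [-> dl]] [l' [-> dl']].
pose mul (t t' : nat * {ffun 'I_n -> int}) : nat * {ffun 'I_n -> int} :=
  ((t.1 * t'.1)%N, [ffun i => t.2 i + t'.2 i]).
exists [seq mul t t' | t <- l, t' <- l']; split.
  rewrite big_allpairs_dep mulr_suml; apply: eq_bigr => t _; rewrite mulr_sumr.
  by apply: eq_bigr => t' _; rewrite /= natrM monomialM; ring.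
move=> _ /allpairsP[[t t'] [/= tl tl' ->]] j /=.
under eq_bigr => i _ do rewrite ffunE mulrDl.
by rewrite big_split lerD // ?dl ?dl'.
Qed.

Lemma expands_monomial (e : {ffun 'I_n -> int}) :
  expands (monomial c e) (fun j => \sum_i e i * d j i).
Proof.
exists [:: (1%N, e)]; rewrite big_seq1 mul1r; split=> // t.
by rewrite inE => /eqP ->.
Qed.

Lemma monomial_delta i0 (a : int) :
  monomial c [ffun i => if i == i0 then a else 0] = c i0 ^ a.
Proof.
rewrite /monomial (bigD1 i0) //= ffunE eqxx big1 ?mulr1 // => i ii0.
by rewrite ffunE (negbTE ii0) expr0z.
Qed.

Lemma expands_power i0 (a : int) : expands (c i0 ^ a) (fun j => a * d j i0).
Proof.
rewrite -monomial_delta; apply: expands_le (expands_monomial _) => j.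
rewrite (bigD1 i0) //= ffunE eqxx big1 ?addr0 // => i ii0.
by rewrite ffunE (negbTE ii0) mul0r.
Qed.

Lemma expands1 : expands 1 (fun=> 0).
Proof.
exists [:: (1%N, [ffun=> 0])]; rewrite big_seq1 mul1r /monomial big1 => [|i _].
  split=> // t; rewrite inE => /eqP -> j; rewrite big1 // => i _.
  by rewrite ffunE mul0r.
by rewrite ffunE expr0z.
Qed.

Lemma expandsX y w m : expands y w -> expands (y ^+ m) (fun j => w j *+ m).
Proof.
move=> yw; elim: m => [|m IH]; first exact: expands1.
by rewrite exprS; apply: expands_le (expandsM yw IH) => j; rewrite mulrS.
Qed.

Lemma expands_prod (I : finType) (f : I -> F) (w : I -> J -> int) :
  (forall i, expands (f i) (w i)) -> expands (\prod_i f i) (fun j => \sum_i w i j).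
Proof.
move=> fw; elim: (index_enum I) => [|i r IH].
  by rewrite big_nil; apply: expands_le expands1 => j; rewrite big_nil.
rewrite big_cons; apply: expands_le (expandsM (fw i) IH) => j.
by rewrite [X in _ <= X]big_cons.
Qed.

End Expansion.

Section ArcExpansion.

Local Open Scope ring_scope.

Variables (F : fieldType) (n : nat) (X : marked n -> marked n -> F).
Variable (T : {ffun 'I_n -> polygon_arc n}).
Hypotheses (ptX : ptolemaic X) (labT : labelled_triangulation T).
Hypothesis T_nz : forall i, arc_value X (T i) != 0.
Implicit Types (a b p q u v : marked n) (g : polygon_arc n).

(** The exponent of [x_g] in the denominator of the expansion of [X u v] in a
    triangulation that contains [g], negative if [u v] is [g] itself. *)
Definition crossing_degree g u v : int :=
  (cross (val g).1 (val g).2 u v)%:Z - (joins g u v)%:Z.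

Definition crossing_grading g i : int := crossing_degree g (val (T i)).1 (val (T i)).2.

Lemma same_pairE g u v : joins g u v = same_pair (val g).1 (val g).2 u v.
Proof.
by rewrite /joins /same_pair; case: (val g) => r s /=; rewrite !xpair_eqE.
Qed.

Lemma crossing_degreeC g u v : crossing_degree g u v = crossing_degree g v u.
Proof. by rewrite /crossing_degree joinsC cross_swapr. Qed.

Lemma crossing_degree_joins g h u v : joins h u v ->
  crossing_degree g (val h).1 (val h).2 = crossing_degree g u v.
Proof. by case/orP=> /eqP -> //=; rewrite crossing_degreeC. Qed.

Lemma crossing_degree_seg g u v : seg u v -> crossing_degree g u v = 0.
Proof.
by move=> sg; rewrite /crossing_degree crossC (negbTE (seg_cross _ _ sg)) (negbTE (seg_joins _ sg)).
Qed.

(** One half of the tropical form of Ptolemy's relation; the other half is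
    obtained by rotating the quadrilateral. *)
Lemma crossing_degree_ptolemy g a p b q : cyc a p b -> cyc b q a ->
  crossing_degree g p b + crossing_degree g q a <=
  crossing_degree g a b + crossing_degree g p q.
Proof.
move=> apb bqa; rewrite /crossing_degree !same_pairE.
have := cross_ptolemy (val g).1 (val g).2 apb bqa.
move: (cross _ _ p b) (cross _ _ q a) (cross _ _ a b) (cross _ _ p q).
move: (same_pair _ _ p b) (same_pair _ _ q a) (same_pair _ _ a b) (same_pair _ _ p q).
by clear; lia.
Qed.

Lemma cross_joins g u v (r s : nat) : joins g u v ->
  cross (val g).1 (val g).2 r s = cross u v r s.
Proof. by case/orP=> /eqP -> //=; rewrite cross_swap. Qed.

Lemma uncrossed_side S u v : triangulation S -> u != v ->
  (forall g, g \in S -> ~~ cross (val g).1 (val g).2 u v) -> side S u v.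
Proof.
move=> triS uv nc; apply: side_max => // r s /sideP[sg|[g gS gj]].
  by rewrite crossC seg_cross.
by apply: contra (nc g gS); rewrite crossC (cross_joins _ _ gj).
Qed.

(** An arc [p q] of [T] that crosses [u v] makes Ptolemy's relation express
    [X u v] through the sides of the quadrilateral [u p v q], which cross fewer
    arcs of [T]; the degrees are controlled by [crossing_degree_ptolemy]. *)
Lemma chord_expands u v : u != v ->
  expands (fun i => arc_value X (T i)) crossing_grading (X u v)
    (fun g => crossing_degree g u v).
Proof.
pose cr u v := #|[set i | cross (val (T i)).1 (val (T i)).2 u v]|.
have [XC X1 XP] := ptX; have [_ triT] := labT; rewrite -/(arcs T) in triT.
have [m] := ubnP (cr u v); elim: m u v => // m IH u v lt_m uv.
case: (pickP (fun i => cross (val (T i)).1 (val (T i)).2 u v)) => [i ci | nc]; last first.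
  have /sideP[sg | [h /imsetP[i _ ->] gj]] : side (arcs T) u v.
    by apply: uncrossed_side => // h /imsetP[i _ ->]; rewrite nc.
    rewrite X1 //; apply: expands_le (expands1 _ _) => g.
    by rewrite crossing_degree_seg.
  rewrite -(arc_value_joins ptX gj) -[arc_value X (T i)]expr1z.
  apply: expands_le (expands_power _ _ i 1) => g; rewrite mul1r.
  by rewrite /crossing_grading (crossing_degree_joins g gj).
have [p [q [Tj upv vqu]]] : exists p q, [/\ joins (T i) p q, cyc u p v & cyc v q u].
  move: ci; rewrite crossC => /orP[] /andP[c1 c2].
    by exists (val (T i)).1, (val (T i)).2; rewrite joins_val.
  by exists (val (T i)).2, (val (T i)).1; rewrite joinsC joins_val.
have [up pv _] := cyc_ord_neq upv; have [vq qu _] := cyc_ord_neq vqu.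
have XT : X p q != 0 by rewrite -(arc_value_joins ptX Tj).
have IHside u' v' : u' \in [:: p; q] -> u' != v' ->
    (forall r s : marked n, ~~ cross r s p q -> cross r s u' v' -> cross r s u v) ->
    expands (fun i => arc_value X (T i)) crossing_grading (X u' v')
      (fun g => crossing_degree g u' v').
  move=> u'pq neq sub; apply: IH neq; rewrite -ltnS; apply: leq_trans lt_m; rewrite ltnS.
  apply/proper_card/properP; split.
    apply/subsetP => j; rewrite !inE; apply: sub.
    have sj : side (arcs T) (val (T j)).1 (val (T j)).2.
      by rewrite (side_arc _ (joins_val _)) mem_arcs.
    have si : side (arcs T) p q by rewrite (side_arc _ Tj) mem_arcs.
    exact: side_cross triT sj si.
  exists i; rewrite !inE // (cross_joins _ _ Tj); apply/negP => /cross_endpoints/and4P[].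
  by move: u'pq; rewrite !inE => /orP[] /eqP ->; rewrite eqxx.
have sub (r s : marked n) := @cross_side_diagonal u p v q r s upv vqu.
have Xpv : expands (fun i => arc_value X (T i)) crossing_grading (X p v)
    (fun g => crossing_degree g p v).
  by apply: IHside; rewrite ?inE ?eqxx // => r s nc h; apply: sub; rewrite ?h ?orbT.
have Xqu : expands (fun i => arc_value X (T i)) crossing_grading (X q u)
    (fun g => crossing_degree g q u).
  by apply: IHside; rewrite ?inE ?eqxx ?orbT // => r s nc h; apply: sub; rewrite ?h ?orbT.
have Xup : expands (fun i => arc_value X (T i)) crossing_grading (X u p)
    (fun g => crossing_degree g p u).
  rewrite XC; apply: IHside; rewrite ?inE ?eqxx 1?eq_sym // => r s nc h.
  by apply: sub; rewrite // [cross r s u p]cross_swapr h.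
have Xvq : expands (fun i => arc_value X (T i)) crossing_grading (X v q)
    (fun g => crossing_degree g q v).
  rewrite XC; apply: IHside; rewrite ?inE ?eqxx ?orbT 1?eq_sym // => r s nc h.
  by apply: sub; rewrite // [cross r s v q]cross_swapr h ?orbT.
have -> : X u v = (X p v * X q u + X u p * X v q) * arc_value X (T i) ^ (-1 : int).
  rewrite (arc_value_joins ptX Tj) -(XP _ _ _ _ upv vqu) exprN1.
  by rewrite mulfK.
have /andP[pvq qup] := quad_cyc upv vqu.
apply: expands_le (expandsM T_nz (expandsD (w := fun g =>
    crossing_degree g u v + crossing_degree g p q) _ _) (expands_power _ _ i (-1))).
- move=> g /=; rewrite /crossing_grading (crossing_degree_joins g Tj) mulN1r.
  by rewrite addrK.
- apply: expands_le (expandsM T_nz Xpv Xqu) => g /=.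
  exact: crossing_degree_ptolemy.
- apply: expands_le (expandsM T_nz Xup Xvq) => g /=.
  rewrite (crossing_degreeC g p u) (crossing_degreeC g q v) (crossing_degreeC g u v).
  by rewrite addrC [X in _ <= X]addrC; apply: crossing_degree_ptolemy.
Qed.

End ArcExpansion.

(** * Coefficients of cluster monomials *)

Section Coefficients.

Local Open Scope ring_scope.

Variables (F : fieldType) (iota : {rmorphism rat -> F}) (n : nat) (c : 'I_n -> F).
Hypothesis ind : independent iota c.
Implicit Types (y z : F) (e : {ffun 'I_n -> int}).

Definition has_coef e y (k : int) : Prop :=
  exists2 l, y = laurent_value c l & laurent_coef e l = k.

Lemma has_coef0 e : has_coef e 0 0.
Proof. by exists [::]; rewrite /laurent_value /laurent_coef big_nil. Qed.

Lemma has_coefD e y z k k' : has_coef e y k -> has_coef e z k' -> has_coef e (y + z) (k + k').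
Proof.
move=> [l -> <-] [l' -> <-]; exists (l ++ l').
  by rewrite /laurent_value big_cat.
by rewrite /laurent_coef big_cat.
Qed.

Lemma has_coefMz e y k (a : int) : has_coef e y k -> has_coef e (y *~ a) (k * a).
Proof.
move=> [l -> <-]; exists [seq (t.1 * a, t.2) | t <- l].
  rewrite /laurent_value big_map -mulrzl mulr_sumr; apply: eq_bigr => t _ /=.
  by rewrite intrM [X in _ = X * _]mulrC mulrA.
by rewrite /laurent_coef big_map mulr_suml.
Qed.

Lemma has_coef_uniq e y k k' : has_coef e y k -> has_coef e y k' -> k = k'.
Proof.
move=> ck ck'; have [l yl cl] := has_coefD ck (has_coefMz (-1) ck').
apply/eqP; rewrite -subr_eq0; have := laurent_coef_eq0 (c := c) (l := l) e ind.
by rewrite cl -yl mulrN1z subrr mulrN1 => ->.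
Qed.

Lemma has_coef_sum (I : eqType) (r : seq I) (f : I -> F) (k : I -> int) e :
  (forall i, i \in r -> has_coef e (f i) (k i)) ->
  has_coef e (\sum_(i <- r) f i) (\sum_(i <- r) k i).
Proof.
elim: r => [|i r IH] h; first by rewrite !big_nil; apply: has_coef0.
rewrite !big_cons; apply: has_coefD; first by apply: h; rewrite inE eqxx.
by apply: IH => j jr; apply: h; rewrite inE jr orbT.
Qed.

Lemma has_coef_nonneg e y : (exists l : seq (nat * {ffun 'I_n -> int}),
  y = \sum_(t <- l) t.1%:R * monomial c t.2) -> exists2 k, has_coef e y k & 0 <= k.
Proof.
move=> [l yl]; pose l' := [seq (t.1%:Z, t.2) | t <- l].
exists (laurent_coef e l'); first by exists l'; rewrite // yl /laurent_value big_map.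
by rewrite /laurent_coef big_map sumr_ge0.
Qed.

End Coefficients.

Section Proper.

Local Open Scope ring_scope.

Variables (F : fieldType) (iota : {rmorphism rat -> F}) (n : nat).
Variables (X : marked n -> marked n -> F) (T : {ffun 'I_n -> polygon_arc n}).
Hypotheses (ptX : ptolemaic X) (labT : labelled_triangulation T).
Let c i := arc_value X (T i).
Hypothesis ind : independent iota c.
Implicit Types (g h : polygon_arc n) (G : {ffun polygon_arc n -> nat}).

Let c_nz i : c i != 0. Proof. exact: independent_neq0 ind. Qed.

Lemma joins_arc g h : joins g (val h).1 (val h).2 = (g == h).
Proof.
apply/idP/eqP => [j | ->]; last exact: joins_val.
exact: joins_inj j (joins_val h).
Qed.

Lemma crossing_degree_arc g h :
  crossing_degree g (val h).1 (val h).2 = (crossing g h)%:Z - (g == h)%:Z.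
Proof.
by rewrite /crossing_degree joins_arc (crossing_joins (joins_val g) (joins_val h)).
Qed.

Lemma arc_monomial_expands G :
  expands c (crossing_grading T) (arc_monomial (arc_value X) G)
    (fun g => \sum_h crossing_degree g (val h).1 (val h).2 *+ G h).
Proof.
apply: (expands_prod c_nz) => h; apply: (expandsX c_nz); apply: chord_expands => //.
exact: joins_neq (joins_val h).
Qed.

(** For an arc [g] of the family outside the triangulation, the crossing degree
    of [g] is nonnegative on the triangulation and equal to minus the multiplicity
    of [g] on the family, so no monomial has only nonnegative exponents. *)
Lemma arc_monomial_proper G g : compatible_family G -> (0 < G g)%N -> g \notin arcs T ->
  exists l : seq (nat * {ffun 'I_n -> int}),
    arc_monomial (arc_value X) G = \sum_(t <- l) t.1%:R * monomial c t.2 /\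
    forall t, t \in l -> exists i, t.2 i < 0.
Proof.
move=> compG Gg gT; have [l [Gl dl]] := arc_monomial_expands G.
exists l; split=> // t tl; apply/existsP; apply: contraT => /existsPn t_ge0.
have := dl t tl g; suff -> : \sum_h crossing_degree g (val h).1 (val h).2 *+ G h = - (G g)%:Z.
  suff : 0 <= \sum_i t.2 i * crossing_grading T g i by move: Gg; lia.
  apply: sumr_ge0 => i _; apply: mulr_ge0; first by rewrite leNgt t_ge0.
  rewrite /crossing_grading crossing_degree_arc.
  by rewrite (_ : g == T i = false) ?subr0 //; apply: contraNF gT => /eqP ->; apply: mem_arcs.
rewrite (bigD1 g) //= crossing_degree_arc eqxx (negbTE (crossing_irr g)) big1 ?addr0.
  by rewrite sub0r mulNrn -[X in - X]/((1 : int) *+ G g) natz.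
move=> h hg; case: (posnP (G h)) => [-> //|Gh]; rewrite crossing_degree_arc.
by rewrite (negbTE (compG g h Gg Gh)) eq_sym (negbTE hg) mul0rn.
Qed.

Definition exponents G : {ffun 'I_n -> int} := [ffun i => (G (T i))%:Z].

Lemma arc_monomial_triangulation G : (forall g, (0 < G g)%N -> g \in arcs T) ->
  arc_monomial (arc_value X) G = monomial c (exponents G).
Proof.
move=> sub; rewrite /arc_monomial /monomial (bigID [in arcs T]) /= [X in _ * X]big1 ?mulr1.
  rewrite /arcs big_imset /=; last by have [injT _] := labT; move=> i j _ _; apply: injT.
  by apply: eq_bigr => i _; rewrite ffunE.
move=> g gT; rewrite (_ : G g = 0%N) //; apply/eqP; rewrite -leqn0 leqNgt.
by apply: contra gT; apply: sub.
Qed.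

(** A family that is not contained in the triangulation contributes no monomial
    with nonnegative exponents, and one that is contained in it is a monomial. *)
Lemma arc_monomial_coef G G0 : compatible_family G ->
  (forall g, (0 < G0 g)%N -> g \in arcs T) ->
  has_coef c (exponents G0) (arc_monomial (arc_value X) G) (G == G0)%:Z.
Proof.
move=> compG sub0; case: (boolP [forall g, (0 < G g)%N ==> (g \in arcs T)]) => [/forallP sub|].
  have sub' g : (0 < G g)%N -> g \in arcs T by have /implyP := sub g.
  exists [:: (1, exponents G)].
    by rewrite /laurent_value big_seq1 mul1r arc_monomial_triangulation.
  rewrite /laurent_coef big_mkcond big_seq1 /=.
  rewrite (_ : (exponents G == exponents G0) = (G == G0)); first by case: eqP.
  apply/eqP/eqP => [eGG|-> //]; apply/ffunP => g.
  have zero (H : {ffun polygon_arc n -> nat}) : (forall g, (0 < H g)%N -> g \in arcs T) ->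
      g \notin arcs T -> H g = 0%N.
    by move=> subH; apply: contraNeq; rewrite -lt0n; apply: subH.
  case: (boolP (g \in arcs T)) => [/imsetP[i _ ->]|gT]; last by rewrite !zero.
  by have := congr1 (fun f : {ffun 'I_n -> int} => f i) eGG; rewrite !ffunE => -[].
case/forallPn=> g; rewrite negb_imply => /andP[Gg gT].
have [l [-> prop_l]] := arc_monomial_proper compG Gg gT.
exists [seq (t.1%:Z, t.2) | t <- l]; first by rewrite /laurent_value big_map.
rewrite (_ : G == G0 = false).
  rewrite /laurent_coef big_map big_seq_cond big1 // => t /andP[/prop_l[i ti] /eqP et].
  by rewrite (et : t.2 = _) ffunE in ti.
by apply: contraNF gT => /eqP eG; apply: sub0; rewrite -eG.
Qed.

End Proper.

Section Spanning.

Local Open Scope ring_scope.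

Variables (F : fieldType).
Implicit Types (B : F -> Prop) (y z : F).

Definition int_comb B y : Prop := exists l : seq (F * int),
  {in l, forall t, B t.1} /\ y = \sum_(t <- l) t.1 *~ t.2.

Lemma int_comb_base B y : B y -> int_comb B y.
Proof.
move=> By; exists [:: (y, 1)]; split; last by rewrite big_seq1.
by move=> t; rewrite inE => /eqP ->.
Qed.

Lemma int_combD B y z : int_comb B y -> int_comb B z -> int_comb B (y + z).
Proof.
move=> [l [Bl ->]] [l' [Bl' ->]]; exists (l ++ l'); split; last by rewrite big_cat.
by move=> t; rewrite mem_cat => /orP[/Bl|/Bl'].
Qed.

Lemma int_combMz B y (a : int) : int_comb B y -> int_comb B (y *~ a).
Proof.
move=> [l [Bl ->]]; exists [seq (t.1, t.2 * a) | t <- l]; split.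
  by move=> _ /mapP[t tl ->]; apply: (Bl t).
rewrite big_map -mulrzl mulr_sumr; apply: eq_bigr => t _ /=.
by rewrite mulrzl mulrzA.
Qed.

Lemma int_comb_sum B (I : eqType) (r : seq I) (f : I -> F) :
  (forall i, i \in r -> int_comb B (f i)) -> int_comb B (\sum_(i <- r) f i).
Proof.
elim: r => [|i r IH] h; first by rewrite big_nil; exists [::]; rewrite big_nil.
rewrite big_cons; apply: int_combD; first by apply: h; rewrite inE eqxx.
by apply: IH => j jr; apply: h; rewrite inE jr orbT.
Qed.

Lemma int_combM B y z : (forall b b', B b -> B b' -> int_comb B (b * b')) ->
  int_comb B y -> int_comb B z -> int_comb B (y * z).
Proof.
move=> BM [l [Bl ->]] [l' [Bl' ->]]; rewrite mulr_suml; apply: int_comb_sum => t tl.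
rewrite mulr_sumr; apply: int_comb_sum => t' tl'.
rewrite mulrzAl mulrzAr; apply/int_combMz/int_combMz/BM; [exact: Bl | exact: Bl'].
Qed.

Lemma int_comb_uniq B y : int_comb B y -> exists (l : seq F) (a : F -> int),
  [/\ uniq l, {in l, forall b, B b} & y = \sum_(b <- l) b *~ a b].
Proof.
move=> [l [Bl ->]]; exists (undup [seq t.1 | t <- l]), (fun b => \sum_(t <- l | t.1 == b) t.2).
split; first exact: undup_uniq.
  by move=> b; rewrite mem_undup => /mapP[t tl ->]; apply: (Bl t).
rewrite (eq_bigr (fun b => \sum_(t <- l) if t.1 == b then t.1 *~ t.2 else 0)); last first.
  move=> b _; rewrite mulrz_sumr big_mkcond; apply: eq_bigr => t _.
  by case: eqP => [->|].
rewrite exchange_big /= !big_seq; apply: eq_bigr => t tl.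
rewrite (bigD1_seq t.1) ?undup_uniq ?mem_undup ?map_f //= eqxx big1 ?addr0 // => b bt.
by rewrite eq_sym (negbTE bt).
Qed.

End Spanning.

(** * Resolution of crossings *)

Definition chord_weight (N u v : nat) : nat :=
  let d := ((u - v) + (v - u))%N in (d * (N - d))%N.

Lemma chord_weightC N u v : chord_weight N u v = chord_weight N v u.
Proof. by rewrite /chord_weight addnC. Qed.

Lemma chord_weight_linear N i j k l : (i < j)%N -> (j < k)%N -> (k < l)%N -> (l < N)%N ->
  (chord_weight N i j + chord_weight N k l < chord_weight N i k + chord_weight N j l)%N /\
  (chord_weight N j k + chord_weight N i l < chord_weight N i k + chord_weight N j l)%N.
Proof.
move=> ij jk kl lN.
pose x := (j - i)%N; pose y := (k - j)%N; pose z := (l - k)%N; pose t := (N - (l - i))%N.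
have wE u v p q : (u < v)%N -> (v - u)%N = p -> (N - p)%N = q ->
    chord_weight N u v = (p * q)%N.
  by move=> uv e1 e2; rewrite /chord_weight (eqP (ltnW uv)) add0n e1 e2.
rewrite (wE i j x (y + z + t)%N) ?(wE k l z (x + y + t)%N) ?(wE i k (x + y)%N (z + t)%N)
  ?(wE j l (y + z)%N (x + t)%N) ?(wE j k y (x + z + t)%N) ?(wE i l (x + y + z)%N t) //;
  try (rewrite /x /y /z /t; move: ij jk kl lN; clear; lia).
have [x0 y0 z0 t0] : [/\ (0 < x)%N, (0 < y)%N, (0 < z)%N & (0 < t)%N].
  by rewrite /x /y /z /t; move: ij jk kl lN; clear; split; lia.
move: x y z t x0 y0 z0 t0; clear => x y z t x0 y0 z0 t0.
have yt : (0 < y * t)%N by rewrite muln_gt0 y0.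
have xz : (0 < x * z)%N by rewrite muln_gt0 x0.
by rewrite !(mulnDl, mulnDr); split; lia.
Qed.

(** The weight of a chord of a polygon with [N] vertices, the product of the
    numbers of steps on both sides, is a strictly concave function of its length;
    so a pair of crossing chords is heavier than two opposite sides. *)
Lemma chord_weight_ptolemy N (a p b q : nat) : cyc a p b -> cyc b q a ->
  (a < N)%N -> (p < N)%N -> (b < N)%N -> (q < N)%N ->
  (chord_weight N p b + chord_weight N q a < chord_weight N a b + chord_weight N p q)%N.
Proof.
move=> apb bqa aN pN bN qN; have := linear_of_cyclic apb bqa.
case/or4P=> /and3P[l1 l2 l3].
- have [_] := chord_weight_linear l1 l2 l3 qN.
  by rewrite (chord_weightC N q a).
- have [+ _] := chord_weight_linear l1 l2 l3 aN.
  by rewrite (chord_weightC N b a) [X in (_ < X)%N -> _]addnC.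
- have [_] := chord_weight_linear l1 l2 l3 pN.
  by rewrite (chord_weightC N b a) (chord_weightC N q p) (chord_weightC N b p) addnC.
- have [+ _] := chord_weight_linear l1 l2 l3 bN.
  by rewrite (chord_weightC N q p) addnC [X in (_ < X)%N -> _]addnC.
Qed.

Section Resolution.

Local Open Scope ring_scope.

Variables (F : fieldType) (n : nat) (X : marked n -> marked n -> F).
Hypothesis ptX : ptolemaic X.
Implicit Types (g h : polygon_arc n) (G : {ffun polygon_arc n -> nat}).
Implicit Types (l : seq (marked n * marked n)).

Definition compatible_monomial (y : F) : Prop :=
  exists2 G, compatible_family G & y = arc_monomial (arc_value X) G.

Definition chord_product l : F := \prod_(p <- l) X p.1 p.2.

Let weight l : nat := (\sum_(p <- l) chord_weight n.+3 p.1 p.2)%N.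

Lemma uncrossed_product l : all (fun p => p.1 != p.2) l ->
  (forall p q : marked n * marked n, p \in l -> q \in l -> ~~ cross p.1 p.2 q.1 q.2) ->
  compatible_monomial (chord_product l).
Proof.
move=> /allP neq nc; exists [ffun g => (\sum_(p <- l) joins g p.1 p.2)%N].
  move=> g h; rewrite !ffunE.
  have ex (k : polygon_arc n) : (0 < \sum_(p <- l) joins k p.1 p.2)%N ->
      exists2 p, p \in l & joins k p.1 p.2.
    rewrite lt0n sum_nat_seq_neq0 => /hasP[p pl]; rewrite /= eqb0 negbK.
    by exists p.
  move=> /ex[p pl gj] /ex[q ql hj]; rewrite /compatible (crossing_joins gj hj).
  exact: nc.
rewrite /chord_product /arc_monomial.
under [RHS]eq_bigr => g _ do rewrite ffunE GRing.expr_sum.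
rewrite exchange_big /= !big_seq; apply: eq_bigr => p pl.
by rewrite (prod_joins ptX (neq p pl)).
Qed.

(** Ptolemy's relation rewrites a product of two crossing chords as a sum of
    products of sides, and this terminates since the weight decreases. *)
Lemma chord_product_comb l : all (fun p => p.1 != p.2) l ->
  int_comb compatible_monomial (chord_product l).
Proof.
have [XC _ XP] := ptX.
have [m] := ubnP (weight l); elim: m l => // m IH l lt_m neq.
case: (boolP (has (fun p : marked n * marked n =>
    has (fun q : marked n * marked n => cross p.1 p.2 q.1 q.2) l) l)) => [|nc]; last first.
  apply/int_comb_base/uncrossed_product => // p q pl ql.
  by apply: contra nc => c; apply/hasP; exists p => //; apply/hasP; exists q.
case/hasP=> -[u v] uvl /hasP[[r s] rsl] /= c.
have [r' [s' [urv vsu eX ew]]] : exists r' s' : marked n, [/\ cyc u r' v, cyc v s' u,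
    X r s = X r' s' & chord_weight n.+3 r s = chord_weight n.+3 r' s'].
  case/orP: (c) => /andP[c1 c2]; first by exists r, s.
  by exists s, r; rewrite XC chord_weightC.
have uv_rs : (r, s) != (u, v).
  by apply: contraTneq c => -[-> ->]; apply: cross_irr.
pose l' := rem (r, s) (rem (u, v) l).
have perm_l : perm_eq l [:: (u, v), (r, s) & l'].
  apply: perm_trans (perm_to_rem uvl) _; rewrite perm_cons.
  by apply: perm_to_rem; apply: rem_mem.
have neq' : all (fun p : marked n * marked n => p.1 != p.2) l'.
  by move: neq; rewrite (perm_all _ perm_l) => /and3P[].
have w_l : weight l = (chord_weight n.+3 u v + (chord_weight n.+3 r' s' + weight l'))%N.
  by rewrite /weight (perm_big _ perm_l) !big_cons /= ew.
have -> : chord_product l = chord_product [:: (r', v), (s', u) & l']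
                          + chord_product [:: (u, r'), (v, s') & l'].
  rewrite /chord_product (perm_big _ perm_l) !big_cons /= eX.
  by rewrite !mulrA (XP _ _ _ _ urv vsu) mulrDl.
have [ur rv _] := cyc_ord_neq urv; have [vs su _] := cyc_ord_neq vsu.
have /andP[rvs sur] := quad_cyc urv vsu.
apply: int_combD; apply: IH; rewrite /= ?rv ?su ?ur ?vs ?neq' //.
  have := chord_weight_ptolemy urv vsu (ltn_ord u) (ltn_ord r') (ltn_ord v) (ltn_ord s').
  move: lt_m; rewrite w_l [weight [:: (r', v), (s', u) & l']]big_cons big_cons -/(weight l') /=.
  move: (weight l') (chord_weight _ _ _) (chord_weight _ _ _) (chord_weight _ _ _).
  by move: (chord_weight _ _ _); clear; lia.
have := chord_weight_ptolemy rvs sur (ltn_ord r') (ltn_ord v) (ltn_ord s') (ltn_ord u).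
rewrite (chord_weightC _ v u).
move: lt_m; rewrite w_l [weight [:: (u, r'), (v, s') & l']]big_cons big_cons -/(weight l') /=.
move: (weight l') (chord_weight _ _ _) (chord_weight _ _ _) (chord_weight _ _ _).
by move: (chord_weight _ _ _); clear; lia.
Qed.

Lemma arc_monomial_product G : exists2 l, all (fun p => p.1 != p.2) l &
  arc_monomial (arc_value X) G = chord_product l.
Proof.
exists (flatten [seq nseq (G g) (val g) | g <- enum {: polygon_arc n}]).
  apply/allP => p /flatten_mapP[g _ /nseqP[-> _]]; exact: joins_neq (joins_val g).
rewrite /chord_product big_flatten big_map big_enum; apply: eq_bigr => g _.
by rewrite big_nseq; elim: (G g) => //= m IH; rewrite exprS IH.
Qed.

Lemma compatible_monomialM y z : compatible_monomial y -> compatible_monomial z ->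
  int_comb compatible_monomial (y * z).
Proof.
move=> [G _ ->] [G' _ ->]; have [l nl ->] := arc_monomial_product G.
have [l' nl' ->] := arc_monomial_product G'; rewrite /chord_product -big_cat.
by apply: chord_product_comb; rewrite all_cat nl.
Qed.

Lemma compatible_single g : compatible_family [ffun h => (h == g : nat)].
Proof. by move=> h h'; rewrite !ffunE !lt0b => /eqP -> /eqP ->; apply: crossing_irr. Qed.

Lemma arc_value_single g :
  arc_value X g = arc_monomial (arc_value X) [ffun h => (h == g : nat)].
Proof.
rewrite /arc_monomial (bigD1 g) //= ffunE eqxx expr1 big1 ?mulr1 // => h hg.
by rewrite ffunE (negbTE hg).
Qed.

Lemma arc_value_monomial g : compatible_monomial (arc_value X g).
Proof.
rewrite arc_value_single; exists [ffun h => (h == g : nat)] => //.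
exact: compatible_single.
Qed.

Lemma compatible_monomial1 : compatible_monomial 1.
Proof.
exists [ffun=> 0%N]; first by move=> g h; rewrite ffunE.
by rewrite /arc_monomial big1 // => g _; rewrite ffunE.
Qed.

End Resolution.

(** * Uniqueness of atomic bases *)

Section Uniqueness.

Local Open Scope ring_scope.

Variables (F : fieldType) (n : nat) (s : seed_data F n).
Implicit Types (B : F -> Prop) (y z : F) (l : seq F).

Lemma sum_uniq_sub l l' (f : F -> F) : uniq l -> uniq l' -> {subset l <= l'} ->
  \sum_(b <- l) f b = \sum_(b <- l') if b \in l then f b else 0.
Proof.
move=> ul ul' sub; rewrite -big_mkcond -big_filter; apply: perm_big.
apply: uniq_perm; rewrite ?filter_uniq // => b; rewrite mem_filter.
by case: (boolP (b \in l)) => // /sub ->.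
Qed.

Lemma nonneg_combination_base B b : B b -> nonneg_combination B b.
Proof.
move=> Bb; exists [:: b], (fun=> 1%N); split=> //; last by rewrite big_seq1.
by move=> b'; rewrite inE => /eqP ->.
Qed.

Lemma basis_neq0 A B b : Z_basis A B -> B b -> b != 0.
Proof.
case=> _ free _ Bb; apply/eqP => b0.
have Bl : {in [:: b], forall x, B x} by move=> x; rewrite inE => /eqP ->.
have s0 : \sum_(x <- [:: b]) x *~ 1 = 0 by rewrite big_seq1 b0.
by have := free [:: b] (fun=> 1) isT Bl s0 b; rewrite inE eqxx => /(_ isT).
Qed.

Lemma basis_indecomposable A B b y z : Z_basis A B -> B b ->
  nonneg_combination B y -> nonneg_combination B z -> b = y + z -> y != 0 -> y = b.
Proof.
move=> basB Bb [l1 [a1 [u1 B1 ey]]] [l2 [a2 [u2 B2 ez]]] eb y0.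
have [_ free _] := basB; pose l := undup (b :: l1 ++ l2).
have ul : uniq l by apply: undup_uniq.
have s1 : {subset l1 <= l}.
  by move=> x xl; rewrite mem_undup inE mem_cat xl orbT.
have s2 : {subset l2 <= l}.
  by move=> x xl; rewrite mem_undup inE mem_cat xl !orbT.
have sb : b \in l by rewrite mem_undup inE eqxx.
(* the coefficients of the relation [y + z - b = 0] *)
pose a x : int := (if x \in l1 then (a1 x)%:Z else 0) +
  ((if x \in l2 then (a2 x)%:Z else 0) - (x == b)%:Z).
have Bl : {in l, forall x, B x}.
  by move=> x; rewrite mem_undup inE mem_cat => /or3P[/eqP ->|/B1|/B2].
have sum_b : \sum_(x <- l) x *~ (x == b)%:Z = b.
  by rewrite (bigD1_seq b) //= eqxx big1 ?addr0 // => x /negbTE ->.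
have sum0 : \sum_(x <- l) x *~ a x = 0.
  under eq_bigr => x _ do rewrite !mulrzDr mulrNz.
  rewrite !big_split /= sumrN sum_b.
  apply/eqP; rewrite addrA subr_eq0 eb ey ez (sum_uniq_sub _ u1 ul s1) (sum_uniq_sub _ u2 ul s2).
  by apply/eqP; congr (_ + _); apply: eq_bigr => x _; case: ifP.
have a0 := free l a ul Bl sum0.
have yE : y = if b \in l1 then b *+ a1 b else 0.
  rewrite ey (sum_uniq_sub _ u1 ul s1) (bigD1_seq b) //= big1_seq ?addr0 // => x /andP[xb xl].
  have := a0 x xl; rewrite /a (negbTE xb) subr0; case: ifP => // _.
  by case: ifP => _ e; (have -> : a1 x = 0%N by move: e; lia).
move: y0; rewrite yE; have := a0 b sb; rewrite /a eqxx.
case: ifP => [_|_]; last by rewrite eqxx.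
case: ifP => _ e; have : (a1 b <= 1)%N by move: e; lia.
  by case: (a1 b) => [|[|//]]; rewrite ?mulr0n ?eqxx.
by case: (a1 b) => [|[|//]]; rewrite ?mulr0n ?eqxx.
Qed.

(** The elements of an atomic basis are the indecomposable positive elements, a
    description that does not mention the basis. *)
Lemma atomic_basis_sub B B' y : atomic_basis s B -> atomic_basis s B' -> B' y -> B y.
Proof.
move=> [basB posB] [basB' posB'] B'y; have y0 := basis_neq0 basB' B'y.
have /posB[l [a [ul Bl ey]]] : positive_element s y by apply/posB'/nonneg_combination_base.
have [b bl /andP[b0 ab]] : exists2 b, b \in l & (b != 0) && (0 < a b)%N.
  apply/hasP; apply: contraR y0 => /hasPn none; rewrite ey big_seq big1 // => b bl.
  by have := none b bl; rewrite negb_and negbK -leqNgt leqn0 => /orP[] /eqP ->;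
    rewrite ?mul0rn ?mulr0n.
have Bb := Bl b bl.
pose z := \sum_(x <- l) x *+ (a x - (x == b))%N.
have yE : y = b + z.
  rewrite ey /z !(bigD1_seq b bl ul) /= eqxx addrA; congr (_ + _).
    by rewrite -mulrS subn1 prednK.
  by apply: eq_bigr => x /negbTE ->; rewrite subn0.
have Pb : nonneg_combination B' b by apply/posB'/posB/nonneg_combination_base.
have Pz : nonneg_combination B' z by apply/posB'/posB; exists l, (fun x => a x - (x == b))%N.
by rewrite -(basis_indecomposable basB' B'y Pb Pz yE b0).
Qed.

End Uniqueness.

(** * Cluster monomials form the atomic basis *)

Section AtomicBasis.

Local Open Scope ring_scope.

Variables (F : fieldType) (iota : {rmorphism rat -> F}) (n : nat).
Variables (X : marked n -> marked n -> F) (s : seed_data F n).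
Hypothesis ptX : ptolemaic X.
Hypothesis cluster_triangulation : forall c, is_cluster s c ->
  exists2 U, labelled_triangulation U & c = [ffun i => arc_value X (U i)].
Hypothesis triangulation_cluster : forall S : {set polygon_arc n}, triangulation S ->
  exists U, [/\ labelled_triangulation U, arcs U = S
              & is_cluster s [ffun i => arc_value X (U i)]].
Hypothesis cluster_independent : forall c, is_cluster s c -> independent iota c.
Implicit Types (y z b : F) (g : polygon_arc n).

Lemma independent_arcs U : is_cluster s [ffun i => arc_value X (U i)] ->
  independent iota (fun i => arc_value X (U i)).
Proof.
move=> /cluster_independent ind p p0; apply: ind; rewrite -[RHS]p0.
rewrite /mmap; apply: eq_bigr => m _; congr (_ * _).
by rewrite /mmap1; apply: eq_bigr => i _; rewrite ffunE.
Qed.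

Lemma nonneg_laurentP U y : nonneg_laurent [ffun i => arc_value X (U i)] y <->
  exists l : seq (nat * {ffun 'I_n -> int}),
    y = \sum_(t <- l) t.1%:R * monomial (fun i => arc_value X (U i)) t.2.
Proof.
have e (l : seq (nat * {ffun 'I_n -> int})) :
    \sum_(t <- l) t.1%:R * \prod_i ([ffun i => arc_value X (U i)] i ^ t.2 i)%R =
    \sum_(t <- l) t.1%:R * monomial (fun i => arc_value X (U i)) t.2.
  apply: eq_bigr => t _; congr (_ * _); apply: eq_bigr => i _; by rewrite ffunE.
by split=> -[l ->]; exists l; rewrite e.
Qed.

Lemma support_triangulation (G : {ffun polygon_arc n -> nat}) : compatible_family G ->
  exists U, [/\ labelled_triangulation U, forall g, (0 < G g)%N -> g \in arcs U
              & is_cluster s [ffun i => arc_value X (U i)]].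
Proof.
move=> compG; have [S triS sub] : exists2 S, triangulation S & [set g | (0 < G g)%N] \subset S.
  by apply: extend_triangulation => g h; rewrite !inE; apply: compG.
have [U [labU eU clU]] := triangulation_cluster triS; exists U; split=> // g Gg.
by rewrite eU; apply: (subsetP sub); rewrite inE.
Qed.

Lemma cluster_variable_arc y : cluster_variable s y <-> exists g, y = arc_value X g.
Proof.
split=> [[c [/cluster_triangulation[U _ ->] [i ->]]] | [g ->]].
  by exists (U i); rewrite ffunE.
have [U [_ sub clU]] := support_triangulation (@compatible_single n g).
have /imsetP[i _ ->] : g \in arcs U by apply: sub; rewrite ffunE eqxx.
by exists [ffun i => arc_value X (U i)]; split=> //; exists i; rewrite ffunE.
Qed.

Lemma arc_monomial_inj (G G' : {ffun polygon_arc n -> nat}) :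
  compatible_family G -> compatible_family G' ->
  arc_monomial (arc_value X) G = arc_monomial (arc_value X) G' -> G = G'.
Proof.
move=> compG compG' eGG; have [U [labU sub clU]] := support_triangulation compG'.
have ind := independent_arcs clU.
have := arc_monomial_coef ptX labU ind compG' sub; rewrite eqxx -eGG => c1.
have := has_coef_uniq ind (arc_monomial_coef ptX labU ind compG sub) c1.
by case: eqP.
Qed.

Lemma arc_value_inj : injective (arc_value X).
Proof.
move=> g h; rewrite !arc_value_single.
move=> /(arc_monomial_inj (@compatible_single n g) (@compatible_single n h)).
move=> /(congr1 (fun G : {ffun polygon_arc n -> nat} => G g)); rewrite !ffunE eqxx.
by case: eqP.
Qed.

Lemma arc_value_neq0 g : arc_value X g != 0.
Proof.
have [U [_ sub clU]] := support_triangulation (@compatible_single n g).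
have /imsetP[i _ ->] : g \in arcs U by apply: sub; rewrite ffunE eqxx.
exact: independent_neq0 i (independent_arcs clU).
Qed.

Lemma cluster_monomial_compatible y : cluster_monomial s y <-> compatible_monomial X y.
Proof.
split=> [[c [/cluster_triangulation[U labU ->] [e ->]]] | [G compG ->]].
  have [injU triU] := labU; rewrite -/(arcs U) in triU.
  have [nc _] := (triangulationP (arcs U)).1 triU.
  exists [ffun g => (\sum_i (U i == g) * e i)%N].
    have inU g : (0 < \sum_i (U i == g) * e i)%N -> g \in arcs U.
      rewrite lt0n sum_nat_eq0 negb_forall => /existsP[i] /=.
      by case: (eqVneq (U i) g) => [<- _|_]; [apply: mem_arcs | rewrite mul0n].
    by move=> g h; rewrite !ffunE => /inU gU /inU hU; apply: nc.
  rewrite /arc_monomial.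
  under [RHS]eq_bigr => g _ do rewrite ffunE GRing.expr_sum.
  rewrite exchange_big /=; apply: eq_bigr => i _; rewrite ffunE.
  rewrite (bigD1 (U i)) //= eqxx mul1n big1 ?mulr1 // => g gU.
  by rewrite eq_sym (negbTE gU) mul0n.
have [U [labU sub clU]] := support_triangulation compG.
exists [ffun i => arc_value X (U i)]; split=> //; exists (fun i => G (U i)).
rewrite (arc_monomial_triangulation X labU sub); apply: eq_bigr => i _.
by rewrite !ffunE.
Qed.

Variable B : F -> Prop.
Hypothesis BE : forall y, B y <-> compatible_monomial X y.

(** The Laurent coefficient that detects the monomial [b0] is read off in a
    cluster that contains all variables of [b0]: there all other compatible
    monomials have coefficient zero. *)
Lemma detecting_coef b0 : B b0 -> exists U e,
  is_cluster s [ffun i => arc_value X (U i)] /\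
  forall b, B b -> has_coef (fun i => arc_value X (U i)) e b (b == b0)%:Z.
Proof.
move=> /BE[G0 compG0 eb0]; have [U [labU sub clU]] := support_triangulation compG0.
have ind := independent_arcs clU.
have coef G := arc_monomial_coef ptX labU ind (G := G) (G0 := G0).
exists U, (exponents U G0); split=> // b /BE[G compG ->].
have cG := coef G compG sub.
rewrite (_ : (_ == b0) = (G == G0)) // eb0; apply/eqP/eqP => [|-> //].
exact: arc_monomial_inj.
Qed.

Lemma cluster_algebra_prod (I : Type) (r : seq I) (f : I -> F) :
  (forall i, cluster_algebra s (f i)) -> cluster_algebra s (\prod_(i <- r) f i).
Proof.
move=> fA; apply: big_ind => [||i _]; [exact: gen_one | exact: gen_mul | exact: fA].
Qed.

Lemma cluster_algebra0 : cluster_algebra s 0.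
Proof. by rewrite -(subrr 1); apply: gen_sub; apply: gen_one. Qed.

Lemma cluster_algebraD y z : cluster_algebra s y -> cluster_algebra s z ->
  cluster_algebra s (y + z).
Proof.
move=> Ay Az; rewrite -[z]opprK -[- z]sub0r.
by apply: gen_sub Ay (gen_sub cluster_algebra0 Az).
Qed.

Lemma basis_cluster_algebra b : B b -> cluster_algebra s b.
Proof.
move=> /BE[G _ ->]; apply: cluster_algebra_prod => g.
elim: (G g) => [|m IH]; first exact: gen_one.
by rewrite exprS; apply: gen_mul IH; apply/gen_base/cluster_variable_arc; exists g.
Qed.

Lemma detected_coef (c : 'I_n -> F) e b0 (l : seq F) (a : F -> int) k :
  uniq l -> {in l, forall b, B b} -> b0 \in l ->
  (forall b, B b -> has_coef c e b (b == b0)%:Z) -> independent iota c ->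
  has_coef c e (\sum_(b <- l) b *~ a b) k -> a b0 = k.
Proof.
move=> ul Bl b0l det ind.
move=> ck; apply: (has_coef_uniq ind) ck.
have -> : a b0 = \sum_(b <- l) (b == b0)%:Z * a b.
  rewrite (bigD1_seq b0) //= eqxx mul1r big1 ?addr0 // => b /negbTE ->.
  by rewrite mul0r.
by apply: has_coef_sum => b bl; apply/has_coefMz/det/Bl.
Qed.

Lemma cluster_algebra_comb y : cluster_algebra s y -> int_comb B y.
Proof.
have subB z : int_comb (compatible_monomial X) z -> int_comb B z.
  by move=> [l [Bl ->]]; exists l; split=> // t /Bl/BE.
elim=> [z /cluster_variable_arc[g ->]| | z z' _ IH _ IH' | z z' _ IH _ IH'].
- by apply/int_comb_base/BE/arc_value_monomial.
- by apply/int_comb_base/BE/compatible_monomial1.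
- by apply: int_combD IH _; rewrite -mulrN1z; apply: int_combMz.
- apply: int_combM IH IH' => b b' /BE Bb /BE Bb'; apply: subB.
  exact: compatible_monomialM.
Qed.

Lemma nonneg_laurentD (c : cluster F n) y z :
  nonneg_laurent c y -> nonneg_laurent c z -> nonneg_laurent c (y + z).
Proof. by move=> [l ->] [l' ->]; exists (l ++ l'); rewrite big_cat. Qed.

Lemma nonneg_laurent0 (c : cluster F n) : nonneg_laurent c 0.
Proof. by exists [::]; rewrite big_nil. Qed.

Lemma basis_positive b : B b -> positive_element s b.
Proof.
move=> Bb; split=> [|c clc]; first exact: basis_cluster_algebra.
have [U labU ec] := cluster_triangulation clc; rewrite ec in clc *.
have [G _ ->] := (BE b).1 Bb; apply/nonneg_laurentP.
by have [l [el _]] := arc_monomial_expands ptX labU (independent_arcs clc) G; exists l.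
Qed.

Lemma positive_elementD y z : positive_element s y -> positive_element s z ->
  positive_element s (y + z).
Proof.
move=> [Ay py] [Az pz]; split=> [|c clc]; first exact: cluster_algebraD.
by apply: nonneg_laurentD; [apply: py | apply: pz].
Qed.

Lemma positive_element0 : positive_element s 0.
Proof. by split=> [|c _]; [apply: cluster_algebra0 | apply: nonneg_laurent0]. Qed.

Lemma basis_atomic : atomic_basis s B.
Proof.
split; first split.
- exact: basis_cluster_algebra.
- move=> l a ul Bl l0 b0 b0l; have [U [e [clU det]]] := detecting_coef (Bl b0 b0l).
  apply: (detected_coef ul Bl b0l det (independent_arcs clU)).
  by rewrite l0; apply: has_coef0.
- by move=> y /cluster_algebra_comb/int_comb_uniq.
move=> y; split=> [[Ay py] | [l [a [ul Bl ->]]]]; last first.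
  rewrite big_seq; apply: big_ind => [||b bl]; first exact: positive_element0.
    exact: positive_elementD.
  elim: (a b) => [|m IH]; first exact: positive_element0.
  by rewrite mulrS; apply: positive_elementD => //; apply/basis_positive/Bl.
have [l [a [ul Bl ey]]] := int_comb_uniq (cluster_algebra_comb Ay).
exists l, (fun b => `|a b|%N); split=> //; rewrite ey !big_seq; apply: eq_bigr => b0 b0l.
have [U [e [clU det]]] := detecting_coef (Bl b0 b0l).
have [k ck k0] := has_coef_nonneg e ((nonneg_laurentP U y).1 (py _ clU)).
rewrite ey in ck; have -> := detected_coef ul Bl b0l det (independent_arcs clU) ck.
by rewrite -[in LHS](gez0_abs k0).
Qed.

Lemma basis_the_atomic : the_atomic_basis s B.
Proof.
split=> [|B' atB' y]; first exact: basis_atomic.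
split; first exact: atomic_basis_sub basis_atomic atB'.
exact: atomic_basis_sub atB' basis_atomic.
Qed.

End AtomicBasis.

(** * Clusters of the polygon *)

Section PolygonClusters.

Local Open Scope ring_scope.

Variables (F : fieldType) (iota : {rmorphism rat -> F}) (n : nat).
Implicit Types (T U : {ffun 'I_n -> polygon_arc n}) (c : cluster F n).

Lemma triangulation_quiver_valid T : no_loops_no_2cycles (triangulation_quiver T).
Proof.
split=> [i|i j]; rewrite !triangulation_quiverE ?arrow_irr //.
by case: (boolP (arrow _ (T i) _)) => [/arrow_asym -> |_]; [right | left].
Qed.

Lemma exists_flip_path ks T : labelled_triangulation T -> exists U, flip_path ks T U.
Proof.
elim: ks T => [|k ks IH] T labT; first by exists T; apply: flip_nil.
have [U labU flipU] := exists_labelled_flip k labT; have [W pathW] := IH U labU.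
by exists W; apply: flip_cons flipU pathW.
Qed.

Lemma flip_path_quiver ks T U : flip_path ks T U ->
  quiver_mutations ks (triangulation_quiver T) = triangulation_quiver U.
Proof.
elim=> // {ks T U} k ks T U W labT flipU pathW <-.
by rewrite /= (quiver_flip labT (flip_path_source pathW) flipU).
Qed.

Lemma flip_path_seed X ks T U : ptolemaic X -> flip_path ks T U ->
  independent iota [ffun i => arc_value X (T i)] ->
  seed_mutations ks (polygon_seed (arc_value X) T) = polygon_seed (arc_value X) U.
Proof.
move=> ptX; elim=> // {ks T U} k ks T U W labT flipU pathW IH ind /=.
have nz : arc_value X (T k) != 0 by have := independent_neq0 k ind; rewrite ffunE.
have labU := flip_path_source pathW.
have e := seed_flip ptX labT labU flipU nz; rewrite e IH //.
have vs : valid_seed iota (polygon_seed (arc_value X) T).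
  by split=> //; apply: triangulation_quiver_valid.
by have [_] := seed_mutation_valid k vs; rewrite e.
Qed.

(** The flips that lead from [T] to the fan mutate the given seed into one whose
    cluster can be prescribed as values on the fan; the reverse flips undo these
    mutations. *)
Lemma exists_arc_values T c : labelled_triangulation T -> independent iota c ->
  exists2 X, ptolemaic X & polygon_seed (arc_value X) T = (triangulation_quiver T, c).
Proof.
move=> labT ind; have vs : valid_seed iota (triangulation_quiver T, c).
  by split=> //; apply: triangulation_quiver_valid.
have [ks [U [pathU eU]]] := fan_path labT.
have := seed_mutations_valid ks vs; have := seed_mutations_rev ks vs.
have := seed_mutations_quiver ks (triangulation_quiver T, c).
rewrite (flip_path_quiver pathU); case: (seed_mutations _ _) => Q c' /= -> back [_ ind'].
have [X ptX XU] := exists_ptolemaic (flip_path_target pathU) eU (fun i => independent_neq0 i ind').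
have eU' : [ffun i => arc_value X (U i)] = c' by apply/ffunP => i; rewrite ffunE.
exists X => //; rewrite -(flip_path_seed ptX (flip_path_rev pathU)) ?eU' //.
by rewrite /polygon_seed eU'.
Qed.

Section Clusters.

Variables (X : marked n -> marked n -> F) (T : {ffun 'I_n -> polygon_arc n}).
Hypotheses (ptX : ptolemaic X) (labT : labelled_triangulation T).
Hypothesis ind : independent iota [ffun i => arc_value X (T i)].
Let s := polygon_seed (arc_value X) T.

Lemma polygon_cluster c : is_cluster s c ->
  exists2 U, labelled_triangulation U & c = [ffun i => arc_value X (U i)].
Proof.
move=> [ks ->]; have [U pathU] := exists_flip_path ks labT.
exists U; first exact: flip_path_target pathU.
by rewrite (flip_path_seed ptX pathU ind).
Qed.

Lemma polygon_triangulation (S : {set polygon_arc n}) : triangulation S ->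
  exists U, [/\ labelled_triangulation U, arcs U = S
              & is_cluster s [ffun i => arc_value X (U i)]].
Proof.
move=> triS; have [ks [U [pathU eU]]] := flip_connected labT triS.
exists U; split=> //; first exact: flip_path_target pathU.
by exists ks; rewrite (flip_path_seed ptX pathU ind).
Qed.

Lemma polygon_independent c : is_cluster s c -> independent iota c.
Proof.
by apply: independent_cluster; split=> //; apply: triangulation_quiver_valid.
Qed.

Lemma codom_arcs (x : polygon_arc n -> F) U :
  codom [ffun i => x (U i)] =i [seq x g | g in arcs U].
Proof.
move=> y; apply/codomP/imageP => [[i ->]|[_ /imsetP[i _ ->] ->]].
  by exists (U i); rewrite ?mem_arcs ?ffunE.
by exists i; rewrite ffunE.
Qed.

Lemma arc_value_bijection : arc_bijection T [ffun i => arc_value X (T i)] (arc_value X).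
Proof.
split.
- by move=> i; rewrite ffunE.
- split; first exact: arc_value_inj ptX polygon_triangulation polygon_independent.
  exact: cluster_variable_arc polygon_cluster polygon_triangulation.
- split=> [S triS | c /polygon_cluster[U [labU triU] ->]].
    have [U [labU <- clU]] := polygon_triangulation triS.
    by exists [ffun i => arc_value X (U i)] => //; apply: codom_arcs.
  by exists (arcs U) => //; apply: codom_arcs.
- move=> k U U' labU labU' flipU; apply: seed_flip => //.
  exact: arc_value_neq0 polygon_triangulation polygon_independent _.
Qed.

(** Values that follow mutations under flips are determined by their values on
    one triangulation, as any arc is reached by flips. *)
Lemma arc_bijection_unique x : arc_bijection T [ffun i => arc_value X (T i)] x ->
  x =1 arc_value X.
Proof.
move=> [xT _ _ xflip] g.
have [S triS gS] : exists2 S, triangulation S & [set g] \subset S.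
  by apply: extend_triangulation => h h' /set1P -> /set1P ->; apply: crossing_irr.
rewrite sub1set in gS; have [ks [U [pathU eU]]] := flip_connected labT triS.
have path_x ks' V W : flip_path ks' V W ->
    seed_mutations ks' (polygon_seed x V) = polygon_seed x W.
  elim=> // {ks' V W} k ks' V V' W labV flipV pathW <- /=.
  by rewrite (xflip k V V' labV (flip_path_source pathW) flipV).
have eT : polygon_seed x T = polygon_seed (arc_value X) T.
  by congr (_, _); apply/ffunP => i; rewrite !ffunE xT ffunE.
move: gS; rewrite -eU => /imsetP[i _ ->].
have := path_x _ _ _ pathU; rewrite eT (flip_path_seed ptX pathU ind).
by move=> /(congr1 (fun s' : seed_data F n => s'.2 i)); rewrite !ffunE.
Qed.

End Clusters.

End PolygonClusters.

(** * The polygon and type A *)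

Local Open Scope ring_scope.

(** The triangulation by nested arcs, each arrow along the diagram [A_n] telling
    at which end the next arc moves. *)
Lemma type_A_triangulation n (Q : quiver n) : (0 < n)%N -> orientation_of_An Q ->
  exists2 T, labelled_triangulation T & triangulation_quiver T = Q.
Proof.
case: n Q => // m Q _ [s sQ].
pose eps k := (0 < Q (s (inord k)) (s (inord k.+1)))%N.
pose D := nested_arcs m eps; have [injD triD] := nested_arcs_labelled m eps.
rewrite -/(arcs D) in triD.
pose T : {ffun 'I_m.+1 -> polygon_arc m.+1} := [ffun k => D (s^-1%g k)].
have Ts i : T (s i) = nested_arc eps i by rewrite !ffunE permK.
have eT : arcs T = arcs D.
  apply/setP => g; apply/imsetP/imsetP => -[i _ ->].
    by exists (s^-1%g i); rewrite // ffunE.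
  by exists (s i); rewrite // Ts ffunE.
exists T.
  split; last by rewrite -/(arcs T) eT.
  by move=> i j; rewrite ffunE [T j]ffunE => /injD /perm_inj.
have step (i j : 'I_m.+1) : j = i.+1 :> nat ->
    Q (s i) (s j) = arrow (arcs D) (nested_arc eps i) (nested_arc eps j) :> nat /\
    Q (s j) (s i) = arrow (arcs D) (nested_arc eps j) (nested_arc eps i) :> nat.
  move=> ij; have := sQ i j; rewrite ij eqxx /=.
  have epsE : eps i = (0 < Q (s i) (s j))%N.
    by rewrite /eps -ij !inord_val.
  case: (boolP (eps i)) => ei.
    have ar := nested_arrow_forward ij ei; rewrite ar (arrow_asym ar).
    by move: ei; rewrite epsE; case: (Q (s i) _) => [|[|]] // _ [] //; lia.
  have ar := nested_arrow_backward ij ei; rewrite ar (arrow_asym ar).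
  by move: ei; rewrite epsE -leqNgt leqn0 => /eqP ->; rewrite add0n.
have no_arrow (i j : 'I_m.+1) : (i < j)%N -> j != i.+1 :> nat ->
    arrow (arcs D) (nested_arc eps i) (nested_arc eps j) = false /\
    arrow (arcs D) (nested_arc eps j) (nested_arc eps i) = false.
  move=> lt_ij /eqP ij; split; apply/idP => /arrowP[u [v [w [/and3P[j1 j2 _] suw]]]];
    apply: ij.
    exact: nested_side_adjacent lt_ij j1 j2 suw.
  rewrite joinsC in j1; rewrite joinsC in j2; rewrite sideC in suw.
  exact: nested_side_adjacent lt_ij j2 j1 suw.
have far (i j : 'I_m.+1) : (i < j)%N -> j != i.+1 :> nat ->
    Q (s i) (s j) = 0%N /\ Q (s j) (s i) = 0%N.
  move=> lt_ij ij; have := sQ i j; rewrite (negbTE ij) (ltn_eqF (ltnW lt_ij : (i < j.+1)%N)).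
  by move/eqP; rewrite addn_eq0 => /andP[/eqP -> /eqP ->].
apply/matrixP => k l; rewrite -(permKV s k) -(permKV s l).
move: (s^-1%g k) (s^-1%g l) => i j; rewrite triangulation_quiverE eT !Ts.
case: (ltngtP i j) => [lt_ij | lt_ji | /val_inj ->].
- case: (eqVneq (j : nat) i.+1) => [/step[] // | ij].
  by have [-> _] := far i j lt_ij ij; have [-> _] := no_arrow i j lt_ij ij.
- case: (eqVneq (i : nat) j.+1) => [/step[] // | ij].
  by have [_ ->] := far j i lt_ji ij; have [_ ->] := no_arrow j i lt_ji ij.
- by rewrite arrow_irr; have := sQ j j; rewrite (ltn_eqF (ltnSn j)) /=; lia.
Qed.

Section MainResults.

Variables (F : fieldType) (iota : {rmorphism rat -> F}) (n : nat).

Lemma ratr_morph a : ratr a = iota a.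
Proof. by rewrite /ratr -[in RHS](divq_num_den a) fmorph_div !rmorph_int. Qed.

Lemma free_generating_independent (c : cluster F n) : free_generating c -> independent iota c.
Proof.
case=> free _ p p0; apply: free; rewrite -[RHS]p0.
by apply: eq_bigr => m _; rewrite ratr_morph.
Qed.

Lemma polygon_atomic_basis (T : {ffun 'I_n -> polygon_arc n}) (c : cluster F n) :
  labelled_triangulation T -> independent iota c ->
  (exists x, arc_bijection T c x) /\
  (forall x, arc_bijection T c x -> the_atomic_basis (triangulation_quiver T, c)
     (fun y => exists2 G, compatible_family G & y = arc_monomial x G)).
Proof.
move=> labT ind; have [X ptX eX] := exists_arc_values labT ind.
have ec : [ffun i => arc_value X (T i)] = c by case: eX.
have ind' : independent iota [ffun i => arc_value X (T i)] by rewrite ec.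
split; first by exists (arc_value X); rewrite -ec; apply: arc_value_bijection ind'.
move=> x; rewrite -{1}ec => /(arc_bijection_unique ptX labT ind') xX; rewrite -eX.
apply: (basis_the_atomic ptX (polygon_cluster ptX labT ind')
  (polygon_triangulation ptX labT ind') (@polygon_independent _ _ _ _ _ ind')) => y.
have eM G : arc_monomial x G = arc_monomial (arc_value X) G.
  by apply: eq_bigr => g _; rewrite xX.
by split=> -[G compG ->]; exists G; rewrite ?eM.
Qed.

Lemma type_A_atomic_basis (s : seed_data F n) : (0 < n)%N -> valid_seed iota s ->
  type_A s.1 -> the_atomic_basis s (cluster_monomial s).
Proof.
move=> n_gt0 vs [ks]; rewrite -seed_mutations_quiver => An.
have [T labT eT] := type_A_triangulation n_gt0 An.
have vs' := seed_mutations_valid ks vs.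
have [X ptX eX] := exists_arc_values labT vs'.2.
have eS : polygon_seed (arc_value X) T = seed_mutations ks s.
  by rewrite eX eT -surjective_pairing.
have ind' : independent iota [ffun i => arc_value X (T i)].
  by have [_] := vs'; rewrite -eS.
have clE c : is_cluster s c <-> is_cluster (polygon_seed (arc_value X) T) c.
  by rewrite eS; split=> /(is_cluster_mutations ks c vs).
have h1 c : is_cluster s c ->
    exists2 U, labelled_triangulation U & c = [ffun i => arc_value X (U i)].
  by move=> /clE; apply: (polygon_cluster ptX labT ind').
have h2 (S : {set polygon_arc n}) : triangulation S -> exists U,
    [/\ labelled_triangulation U, arcs U = S & is_cluster s [ffun i => arc_value X (U i)]].
  move=> /(polygon_triangulation ptX labT ind')[U [labU eU clU]].
  by exists U; split=> //; apply/clE.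
have h3 c : is_cluster s c -> independent iota c by apply: independent_cluster.
apply: (basis_the_atomic ptX h1 h2 h3); exact: cluster_monomial_compatible h1 h2.
Qed.

End MainResults.

Theorem theorem1p1 (n : nat) (hn : (1 <= n)%N) :
  (forall (T : {ffun 'I_n -> polygon_arc n})
          (c : cluster {fraction {mpoly rat[n]}} n),
     labelled_triangulation T -> free_generating c ->
     (exists x, arc_bijection T c x) /\
     (forall x, arc_bijection T c x ->
        the_atomic_basis (triangulation_quiver T, c)
          (fun y => exists2 G, compatible_family G & y = arc_monomial x G)))
  /\
  (forall s : seed_data {fraction {mpoly rat[n]}} n,
     is_seed s -> type_A s.1 ->
     the_atomic_basis s (cluster_monomial s)).
Proof.
pose iota : {rmorphism rat -> {fraction {mpoly rat[n]}}} :=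
  (@tofrac {mpoly rat[n]} \o @mpolyC n rat)%FUN.
split=> [T c labT freec | s [Qs _ frees] typeA].
  exact: (polygon_atomic_basis labT (free_generating_independent (iota := iota) freec)).
apply: (type_A_atomic_basis (iota := iota)) => //; split=> //.
exact: free_generating_independent.
Qed.
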